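(* Suppose that: (i) for every $x\in\chi$, $f_x$ is uniformly bounded and Lipschitz continuous on $Y$ with constant $L_1>0$; (ii) for every $x\in\chi$, $y\in Y$ the noise $\epsilon_x(y)$ is normally distributed with mean $0$ and standard deviation $\sigma_x(y)\in(0,\infty)$, and every $\sigma_x:Y\to\mathbb{R}$ is Lipschitz continuous on $Y$ with constant $L_2>0$; (iii) the errors $\epsilon_{[i]}$ are mutually independent. Let the data be generated by a (dynamic) sequential random sampling rule $\{a^{(t)}\}_t$ for which there is a constant $\lambda_L>0$ with $a^{(t)}(x,y)>\lambda_L$ for all $t$, $x\in\chi$, $y\in Y^\circ$. Then for every $x\in\chi$ and $y\in Y^\circ$, as $t\to\infty$, $$\hat f_x^{(t)}(y)\to f_x(y)\quad\text{a.s.}\qquad\text{and}\qquad \hat\sigma_x^{(t)}(y)\to\sigma_x(y)\quad\text{a.s.}$$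
   Context: Setting. $\chi$ is a finite set of decisions; $Y\subset\mathbb{R}^d$ is a bounded set of contexts with interior $Y^\circ$; $f_x:Y\to\mathbb{R}$ is the unknown expected performance of decision $x$. The $i$-th simulation run at the point $(x_{[i]},y_{[i]})$ returns $\tilde G_{[i]}=f_{x_{[i]}}(y_{[i]})+\epsilon_{[i]}$, where $\epsilon_{[i]}$ has the law of $\epsilon_{x_{[i]}}(y_{[i]})$. Write $\gamma_{[i]}=((x_{[i]},y_{[i]}),\tilde G_{[i]})$ and $\mathcal D^{(t)}=(\gamma_{[1]},\dots,\gamma_{[t]})$. Mutual independence of the errors means that the runs use fresh independent noise: the standardized errors $\epsilon_{[i]}/\sigma_{x_{[i]}}(y_{[i]})$ are i.i.d. standard normal and the $i$-th one is independent of $(\mathcal D^{(i-1)},x_{[i]},y_{[i]})$. Sampling. At each stage $t$ one point $(x_{[t]},y_{[t]})\in\chi\times Y^\circ$ is drawn; conditionally on $\mathcal D^{(t-1)}$ it has density $a^{(t)}(x,y)=p_x^{(t)}f^{(t)}_{Y|x}(y)$ with respect to (counting measure on $\chi$) $\times$ (Lebesgue measure on $Y^\circ$), where $p^{(t)}_x>0$, $\sum_x p_x^{(t)}=1$, and $f^{(t)}_{Y|x}$ is a probability density. The function $a^{(t)}$ may be predetermined or may depend on $\mathcal D^{(t-1)}$. Shrinking Neighborhood Estimation (SNE). Fix constants $\xi>0$, $c>0$ and put $r_m=c\,m^{-\xi/d}$, $m=1,2,\dots$. For $x\in\chi$, $y\in Y^\circ$ let $b_m^{(t)}(x,y)=\{\gamma_{[i]}\in\mathcal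 D^{(t)}: x_{[i]}=x,\ \|y_{[i]}-y\|<r_m,\ y_{[i]}\in Y^\circ\}$. The $m$-set is activated at stage $t$ if $|b_m^{(t)}(x,y)|\ge m$. Let $\tau_m^{(t)}(x,y)=\min\{t'\le t: |b_m^{(t')}(x,y)|=m\}$ if it is activated at stage $t$, and $\infty$ otherwise. Let $\Psi^{(t)}_{x,y}$ be the largest $m$ activated at stage $t$, and $\tau^{(t)}_{x,y}$ the stage at which that $m$-set was first activated (equivalently, the largest finite $\tau_m^{(t)}(x,y)$). The neighborhood sample set is $b_{x,y}^{(t)}=b^{(\tau^{(t)}_{x,y})}_{\Psi^{(t)}_{x,y}}(x,y)$; it has exactly $\Psi^{(t)}_{x,y}$ elements. The estimators are $$\hat f_x^{(t)}(y)=\frac{1}{\Psi^{(t)}_{x,y}}\sum_{i:\gamma_{[i]}\in b^{(t)}_{x,y}}\tilde G_{[i]},\qquad \hat\sigma_x^{(t)}(y)=\sqrt{\frac{1}{\Psi^{(t)}_{x,y}-1}\sum_{i:\gamma_{[i]}\in b^{(t)}_{x,y}}\big[\tilde G_{[i]}-\hat f_x^{(t)}(y)\big]^2}.$$ Where these are undefined (no activated $m$-set, respectively $\Psi^{(t)}_{x,y}\le 1$) they are given arbitrary values. *)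

(* Defs.v *)
From HB Require Import structures.
From mathcomp Require Import all_boot all_order all_algebra.
From mathcomp Require Import all_classical all_reals all_analysis.

Set Implicit Arguments.
Unset Strict Implicit.
Unset Printing Implicit Defensive.
Import Order.TTheory GRing.Theory Num.Theory.
Import numFieldNormedType.Exports.
Local Open Scope classical_set_scope.
Local Open Scope ring_scope.

(* Measurable types are pointed in the library, hence the point [x0], which is
   used for nothing else. *)

Definition discrete (T : finType) (x0 : T) : Type := T.

Section discrete_instances.
Context (T : finType) (x0 : T).
HB.instance Definition _ := Finite.on (discrete x0).
HB.instance Definition _ := isPointed.Build (discrete x0) x0.
HB.instance Definition _ :=
  @isMeasurable.Build default_measure_display (discrete x0)
    (@discrete_measurable T) (@discrete_measurable0 T)
    (@discrete_measurableC T) (@discrete_measurableU T).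
End discrete_instances.

(* The library norm on ['rV[R]_d] is the sup norm, not the Euclidean one; the
   two have the same open sets and the same bounded sets, and only for these is
   the library norm used. *)

Definition enorm (R : realType) (d : nat) (v : 'rV[R]_d) : R :=
  Num.sqrt (\sum_(i < d) v ord0 i ^+ 2).

Definition elipschitz_on (R : realType) (d : nat) (L : R) (A : set 'rV[R]_d)
    (g : 'rV[R]_d -> R) : Prop :=
  forall u v, A u -> A v -> `|g u - g v| <= L * enorm (u - v).

Section borel_rV.
Context (R : realType) (d : nat).

Let coord (i : 'I_d) (v : 'rV[R]_d) : R := v ord0 i.

Let borel0 : g_sigma_preimage coord set0.
Proof. exact: sigma_algebra0. Qed.

Let borelC A : g_sigma_preimage coord A -> g_sigma_preimage coord (~` A).
Proof. exact: sigma_algebraC. Qed.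

Let borelU (F : (set 'rV[R]_d)^nat) :
  (forall i, g_sigma_preimage coord (F i)) ->
  g_sigma_preimage coord (\bigcup_i F i).
Proof. exact: sigma_algebra_bigcup. Qed.

(* The Borel sigma-algebra, presented as the one generated by the coordinates. *)
HB.instance Definition _ :=
  @isMeasurable.Build default_measure_display 'rV[R]_d
    (g_sigma_preimage coord) borel0 borelC borelU.

Lemma measurable_coord (i : 'I_d) :
  measurable_fun setT (fun v : 'rV[R]_d => v ord0 i).
Proof.
move=> _ A mA; rewrite setTI; apply: sub_sigma_algebra => /=.
rewrite -bigcup_seq/=; exists i => /=; first by rewrite mem_index_enum.
by exists A => //; rewrite setTI.
Qed.

Lemma measurable_fun_rV d1 (T : measurableType d1) (g : T -> 'rV[R]_d) :
  (forall i, measurable_fun setT (fun x => g x ord0 i)) -> measurable_fun setT g.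
Proof.
move=> mg; rewrite -[X in measurable_fun _ X]/g => _.
have : preimage_set_system setT g (g_sigma_preimage coord) `<=` measurable.
  rewrite -g_sigma_preimageE.
  apply: smallest_sub; first exact: sigma_algebra_measurable.
  move=> _ [C + <-].
  rewrite -bigcup_seq => -[i _ [A mA <-]]; rewrite !setTI.
  by have := mg i measurableT A mA; rewrite setTI.
by move=> h A mA; apply: h; exists A.
Qed.

End borel_rV.

(* [lebesgue_rV R d] is the d-fold product of the Lebesgue measure on R,
   transported from nested pairs to row vectors; see [lebesgue_rV_box]. *)

Section lebesgue_rV.
Context (R : realType).

Definition rV_cons (n : nat) (z : measurableTypeR R * 'rV[R]_n) : 'rV[R]_n.+1 :=
  \row_(i < n.+1) (if unlift ord0 i is Some j then z.2 ord0 j else z.1).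

Definition rV_uncons (n : nat) (v : 'rV[R]_n.+1) : measurableTypeR R * 'rV[R]_n :=
  (v ord0 ord0, \row_(j < n) v ord0 (lift ord0 j)).

Lemma rV_consK n : cancel (@rV_cons n) (@rV_uncons n).
Proof.
move=> [x v]; rewrite /rV_uncons /rV_cons; congr pair.
  by rewrite mxE unlift_none.
by apply/rowP => j; rewrite !mxE liftK.
Qed.

Lemma measurable_rV_cons n : measurable_fun setT (@rV_cons n).
Proof.
apply: measurable_fun_rV => i.
under eq_fun do rewrite mxE.
case: unliftP => [j|] _; last exact: measurable_fst.
apply: (measurableT_comp (measurable_coord j)); exact: measurable_snd.
Qed.

Lemma measurable_rV_uncons n : measurable_fun setT (@rV_uncons n).
Proof.
apply/measurable_fun_pairP; split => /=.
  exact: (measurable_coord ord0).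
apply: measurable_fun_rV => j.
by under eq_fun do rewrite /= mxE; exact: measurable_coord.
Qed.

Section step.
Context (n : nat) (mu : {sigma_finite_measure set 'rV[R]_n -> \bar R}).

Definition lebesgue_step : set 'rV[R]_n.+1 -> \bar R :=
  pushforward (lebesgue_measure \x mu)%E (@rV_cons n).

(* The instance of [pushforward] depends on a measurability proof, so it has to
   be given explicitly. *)
HB.instance Definition _ := Measure.copy lebesgue_step
  (measure_function_pushforward__canonical__measure_function_Measure
    (lebesgue_measure \x mu)%E (@measurable_rV_cons n)).

Let sigma_finite_step : sigma_finite setT lebesgue_step.
Proof.
have /sigma_finiteP[F [TF ndF Foo]] :=
  sigma_finiteT (@lebesgue_measure R : {sigma_finite_measure set _ -> \bar R}).
have /sigma_finiteP[G [TG ndG Goo]] := sigma_finiteT mu.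
exists (fun k => @rV_uncons n @^-1` (F k `*` G k)).
  rewrite -preimage_bigcup -[LHS](preimage_setT (@rV_uncons n)).
  congr (_ @^-1` _); rewrite -setXTT TF TG predeqE => -[x y]; split.
    move=> [/= [j _ Fjx] [k _ Gky]]; exists (maxn j k) => //; split.
    - by move: x Fjx; exact/subsetPset/ndF/leq_maxl.
    - by move: y Gky; exact/subsetPset/ndG/leq_maxr.
  by move=> [j _ []/= ? ?]; split; exists j.
move=> k; have [? ?] := Foo k; have [? ?] := Goo k; split.
  by rewrite -[X in measurable X]setTI; apply: measurable_rV_uncons => //;
    exact: measurableX.
rewrite /lebesgue_step /pushforward -comp_preimage.
have -> : @rV_uncons n \o @rV_cons n = id by apply/funext => z; exact: rV_consK.
by rewrite preimage_id product_measure1E// lte_mul_pinfty// ge0_fin_numE.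
Qed.

HB.instance Definition _ :=
  Measure_isSigmaFinite.Build _ _ _ lebesgue_step sigma_finite_step.

End step.

Definition lebesgue_dirac0 : {sigma_finite_measure set 'rV[R]_0 -> \bar R} :=
  \d_(0 : 'rV[R]_0).

Fixpoint lebesgue_rV (n : nat) : {sigma_finite_measure set 'rV[R]_n -> \bar R} :=
  if n is m.+1 then lebesgue_step (lebesgue_rV m) else lebesgue_dirac0.

End lebesgue_rV.

Lemma measurable_rV_box (R : realType) n (a b : 'I_n -> R) :
  measurable [set v : 'rV[R]_n | forall i, v ord0 i \in `]a i, b i]].
Proof.
have -> : [set v : 'rV[R]_n | forall i, v ord0 i \in `]a i, b i]] =
    \big[setI/setT]_(i < n)
      ((fun v : 'rV[R]_n => v ord0 i) @^-1` `]a i, b i]%classic).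
  rewrite -bigcap_seq; apply/seteqP; split => [v h i _ /=|v h i]; first exact: h.
  by apply: (h i); rewrite /= mem_index_enum.
apply: bigsetI_measurable => i _; rewrite -[X in measurable X]setTI.
by apply: measurable_coord => //; exact: measurable_itv.
Qed.

Lemma lebesgue_rV_box (R : realType) n (a b : 'I_n -> R) :
  (forall i, a i <= b i) ->
  lebesgue_rV R n [set v | forall i, v ord0 i \in `]a i, b i]] =
  (\prod_(i < n) (b i - a i))%:E.
Proof.
elim: n a b => [|n IH] a b ab.
  by rewrite big_ord0 /= diracE mem_set //= => -[].
rewrite /= /lebesgue_step /pushforward.
set B := preimage _ _.
have -> : B = `]a ord0, b ord0]%classic `*` [set v : 'rV[R]_n |
    forall i, v ord0 i \in `]a (lift ord0 i), b (lift ord0 i)]].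
  apply/seteqP; split=> [[x v] /= h|[x v] /= [h1 h2] i]; last first.
    by rewrite mxE; case: unliftP => [j ->|->]; [exact: h2|exact: h1].
  split => [|i]; first by have := h ord0; rewrite mxE unlift_none.
  by have := h (lift ord0 i); rewrite mxE liftK.
rewrite product_measure1E; [|exact: measurable_itv|exact: measurable_rV_box].
rewrite IH// [X in (X * _)%E](lebesgue_measure_itv `]a ord0, b ord0]) /=.
rewrite big_ord_recl lte_fin EFinM.
have [_|ba] := ltP (a ord0) (b ord0); first by rewrite EFinB.
have -> : a ord0 = b ord0 by apply/eqP; rewrite eq_le ab ba.
by rewrite subrr !mul0e.
Qed.

(* The estimators are defined along one realized path of decisions [xs],
   contexts [ys] and outputs [gs].  Runs are numbered from 0, so the data after
   [t] stages are the runs of index [i < t]; a set of runs is represented by the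
   increasing sequence of their indices. *)

Section shrinking_neighborhood_estimation.
Context (R : realType) (d : nat) (chi : finType).
Variables (c xi : R) (Y : set 'rV[R]_d).
Variables (xs : nat -> chi) (ys : nat -> 'rV[R]_d) (gs : nat -> R).
Variables (x : chi) (y : 'rV[R]_d).

Definition radius (m : nat) : R := c * m%:R `^ (- (xi / d%:R)).

Definition nbhd (m t : nat) : seq nat :=
  [seq i <- iota 0 t |
    [&& xs i == x, enorm (ys i - y) < radius m & `[< Y° (ys i) >]]].

Definition activated (m t : nat) : bool :=
  (0 < m)%N && (m <= size (nbhd m t))%N.

(* [None] stands for an infinite activation stage.  The list is increasing, so
   [find] returns the first stage at which the neighborhood has [m] runs. *)
Definition activation_stage (m t : nat) : option nat :=
  if activated m t then
    Some (find (fun t' => size (nbhd m t') == m) (iota 0 t.+1))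
  else None.

(* Bounding [m] by [t] loses nothing, as [size (nbhd m t) <= t]; the value is 0
   when no [m] is activated. *)
Definition largest_activated (t : nat) : nat :=
  \max_(m < t.+1 | activated m t) m.

Definition sample_set (t : nat) : seq nat :=
  if activation_stage (largest_activated t) t is Some t'
  then nbhd (largest_activated t) t' else [::].

(* The argument [dflt] is the value given to an estimator where its formula is
   undefined. *)
Definition mean_estimator (dflt : R) (t : nat) : R :=
  let psi := largest_activated t in
  if (0 < psi)%N then psi%:R^-1 * \sum_(i <- sample_set t) gs i else dflt.

Definition sd_estimator (dflt : R) (t : nat) : R :=
  let psi := largest_activated t in
  if (1 < psi)%N then
    Num.sqrt ((psi%:R - 1)^-1 *
      \sum_(i <- sample_set t) (gs i - mean_estimator dflt t) ^+ 2)
  else dflt.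

End shrinking_neighborhood_estimation.

Section independence.
Context dO (Omega : measurableType dO) (R : realType) (P : probability Omega R).

Definition independent_rv d1 d2 (T1 : measurableType d1) (T2 : measurableType d2)
    (U : Omega -> T1) (V : Omega -> T2) : Prop :=
  forall A B, measurable A -> measurable B ->
    P (U @^-1` A `&` V @^-1` B) = (P (U @^-1` A) * P (V @^-1` B))%E.

Definition mutually_independent d1 (T : measurableType d1)
    (U : nat -> Omega -> T) : Prop :=
  forall (s : seq nat) (A : nat -> set T),
    uniq s -> (forall i, measurable (A i)) ->
    P (\big[setI/setT]_(i <- s) (U i @^-1` A i)) =
    (\prod_(i <- s) P (U i @^-1` A i))%E.

End independence.

Section sampling_model.
Context (R : realType) (d : nat) (chi : finType) (x0 : chi).
Context dO (Omega : measurableType dO) (P : probability Omega R).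
Variables (Y : set 'rV[R]_d) (f sigma : chi -> 'rV[R]_d -> R).
Variable noise : chi -> 'rV[R]_d -> probability (measurableTypeR R) R.
Variables (dec : nat -> {RV P >-> discrete x0})
  (ctx : nat -> {RV P >-> 'rV[R]_d}) (err : nat -> {RV P >-> R}).

Definition output (i : nat) (w : Omega) : R :=
  f (dec i w) (ctx i w) + err i w.

Definition point (i : nat) (w : Omega) : discrete x0 * 'rV[R]_d :=
  (dec i w, ctx i w).

Definition history (t : nat) (w : Omega) :
    t.-tuple (discrete x0 * 'rV[R]_d * R)%type :=
  [tuple (point i w, output i w) | i < t].

Definition standardized_error (i : nat) (w : Omega) : R :=
  err i w / sigma (dec i w) (ctx i w).

(* The error of a run has, given the sampled point, the law of the noise at that
   point. *)
Definition errors_follow_noise : Prop :=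
  forall i (B : set (discrete x0 * 'rV[R]_d)) (E : set R),
    measurable B -> measurable E ->
    P (point i @^-1` B `&` err i @^-1` E) =
    (\int[P]_(w in point i @^-1` B) noise (dec i w) (ctx i w) E)%E.

Definition errors_independent : Prop :=
  [/\ forall i (E : set R), measurable E ->
        P (standardized_error i @^-1` E) = normal_prob 0 1 E,
      mutually_independent P standardized_error
    & forall i, independent_rv P (standardized_error i)
        (fun w => (history i w, point i w))].

Variable p : forall t : nat,
  t.-tuple (discrete x0 * 'rV[R]_d * R) -> chi -> R.
Variable fY : forall t : nat,
  t.-tuple (discrete x0 * 'rV[R]_d * R) -> chi -> 'rV[R]_d -> R.

Definition sampling_density (t : nat) (w : Omega) (x : chi) (y : 'rV[R]_d) : R :=
  p (history t w) x * fY (history t w) x y.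

(* The step [t], counted from 0, draws the run of index [t] given the data of
   the runs [i < t]; a predetermined rule is one whose [p] and [fY] ignore their
   history argument. *)
Record sequential_sampling : Prop := {
  p_measurable : forall t x,
    measurable_fun setT (fun h => @p t h x) ;
  fY_measurable : forall t x,
    measurable_fun (setT `*` Y°) (fun hy => @fY t hy.1 x hy.2) ;
  p_gt0 : forall t w x, 0 < p (history t w) x ;
  p_sum1 : forall t w, \sum_(x : chi) p (history t w) x = 1 ;
  fY_ge0 : forall t w x y, Y° y -> 0 <= fY (history t w) x y ;
  fY_int1 : forall t w x,
    (\int[lebesgue_rV R d]_(y in Y°) (fY (history t w) x y)%:E = 1)%E ;
  ctx_interior : forall t w, Y° (ctx t w) ;
  (* [sampling_density t] is the conditional density of the sampled point given
     the history: this is the defining identity of the conditional law. *)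
  conditional_density : forall t H x B, measurable H -> measurable B ->
    P (history t @^-1` H `&` (dec t @^-1` [set x] `&` ctx t @^-1` B)) =
    (\int[P]_(w in history t @^-1` H)
       \int[lebesgue_rV R d]_(y in B `&` Y°) (sampling_density t w x y)%:E)%E
}.

End sampling_model.

(* Main.v *)
Require Import Defs.
From HB Require Import structures.
From mathcomp Require Import all_boot all_order all_algebra.
From mathcomp Require Import all_classical all_reals all_analysis.
From mathcomp Require Import measurable_realfun ring lra.

Set Implicit Arguments.
Unset Strict Implicit.
Unset Printing Implicit Defensive.
Import Order.TTheory GRing.Theory Num.Theory.
Import numFieldNormedType.Exports.
Local Open Scope classical_set_scope.
Local Open Scope ring_scope.

(* For fixed (x, y) and m, select the runs that fall into the m-th neighborhood
   as long as fewer than m runs were selected before.  Selection of run i depends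
   only on the history and on the i-th point, of which the standardized error Z_i
   is independent, so for a likelihood ratio h of a normal law against N(0, 1) the
   product of the h(Z_i) over the selected runs has expectation 1.  Markov's
   inequality then makes deviations of the selected sums of Z_i (tilting the mean)
   and of Z_i^2 (tilting the variance) exponentially unlikely in m, uniformly in
   the stage, and Borel-Cantelli over m gives laws of large numbers along the
   largest activated m.  This index tends to infinity because the density bound
   makes every neighborhood be hit infinitely often; the Lipschitz bounds control
   the bias, which is of the order of the shrinking radius. *)

(** * Likelihood ratios of normal laws *)

(* The integral of a nonnegative function is a supremum over simple functions, so
   this needs no measurability, unlike [ge0_le_integral]. *)
Lemma ge0_le_integral_nonmeasurable d (T : measurableType d) (R : realType)
    (mu : {measure set T -> \bar R}) (D : set T) (f g : T -> \bar R) :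
  (forall x, D x -> 0 <= f x)%E -> (forall x, D x -> f x <= g x)%E ->
  (\int[mu]_(x in D) f x <= \int[mu]_(x in D) g x)%E.
Proof.
move=> f0 fg; have g0 x : D x -> (0 <= g x)%E.
  by move=> Dx; exact: le_trans (f0 x Dx) (fg x Dx).
rewrite !ge0_integralE//; apply: le_ereal_sup => _ [h /= hf <-].
exists h => // x; apply: (le_trans (hf x)).
by rewrite !patchE; case: ifPn => // /[!inE] Dx; exact: fg.
Qed.

(** The Radon-Nikodym derivative of the normal law and [normal_pdf] have the same integral over
    every measurable set, hence agree almost everywhere. *)
Lemma integral_normal_prob (R : realType) (m s : R) (h : R -> R) :
  measurable_fun setT h -> (forall z, 0 <= h z) ->
  (\int[normal_prob m s]_z (h z)%:E =
   \int[lebesgue_measure]_z (h z * normal_pdf m s z)%:E)%E.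
Proof.
move=> mh h0; have dom := @normal_prob_dominates R m s.
have mpdf : measurable_fun setT (EFin \o normal_pdf m s).
  by apply/measurable_EFinP; exact: measurable_normal_pdf.
rewrite -(Radon_Nikodym_SigmaFinite.change_of_variables dom)//; last first.
- exact/measurable_EFinP.
apply: ae_eq_integral => //.
- apply: emeasurable_funM; first exact/measurable_EFinP.
  exact: measurable_int (Radon_Nikodym_SigmaFinite.f_integrable dom).
- apply/measurable_EFinP; apply: measurable_funM => //.
  exact: measurable_normal_pdf.
under [X in ae_eq _ _ _ X]eq_fun do rewrite EFinM.
apply: ae_eqe_mul2l; apply: integral_ae_eq => //; last move=> E _ mE.
  exact: Radon_Nikodym_SigmaFinite.f_integrable.
by rewrite -Radon_Nikodym_SigmaFinite.f_integral.
Qed.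

(** The density of the normal law with mean [a] and standard deviation [s] relative to the standard
    normal law. *)
Definition normal_lr (R : realType) (a s z : R) : R :=
  normal_pdf a s z / normal_pdf 0 1 z.

Lemma normal_lr_ge0 (R : realType) (a s z : R) : 0 <= normal_lr a s z.
Proof. by rewrite divr_ge0// normal_pdf_ge0. Qed.

Lemma normal_pdf01_gt0 (R : realType) (z : R) : 0 < normal_pdf 0 1 z.
Proof.
by rewrite normal_pdfE ?oner_neq0// mulr_gt0 ?expR_gt0// normal_peak_gt0 ?oner_neq0.
Qed.

Lemma measurable_fun_invr d (T : measurableType d) (R : realType)
    (g : T -> R) : (forall w, 0 <= g w) ->
  measurable_fun setT g -> measurable_fun setT (fun w => (g w)^-1).
Proof.
move=> g0 mg; under eq_fun do rewrite -powR_inv1//.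
exact: measurableT_comp (measurable_powR _) mg.
Qed.

Lemma measurable_normal_lr (R : realType) (a s : R) :
  measurable_fun setT (normal_lr a s).
Proof.
apply: measurable_funM; first exact: measurable_normal_pdf.
apply: measurable_fun_invr; first by move=> z; exact: normal_pdf_ge0.
exact: measurable_normal_pdf.
Qed.

Lemma integral_normal_lr (R : realType) (a s : R) : s != 0 ->
  (\int[normal_prob 0 1]_z (normal_lr a s z)%:E = 1)%E.
Proof.
move=> s0; rewrite integral_normal_prob//; [|exact: measurable_normal_lr|].
- under eq_integral do rewrite /normal_lr divfK ?gt_eqF ?normal_pdf01_gt0//.
  exact: integral_normal_pdf.
- exact: normal_lr_ge0.
Qed.

(** The sigma-algebra generated by [X] is contained in the ambient one; this transports facts from
    the coarser space to the original one. *)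
Lemma measurable_id_preimage d d' (T : measurableType d)
    (T' : measurableType d') (X : T -> T') : measurable_fun setT X ->
  measurable_fun setT (id : T -> g_sigma_algebra_preimageType X).
Proof. by move=> mX _ _ [B mB <-]; rewrite setTI; exact: mX. Qed.

Lemma measurable_preimageType_comp d d' d'' (T : measurableType d)
    (T' : measurableType d') (T'' : measurableType d'')
    (X : T -> T') (U : T -> T'') : measurable_fun setT X ->
  measurable_fun (setT : set (g_sigma_algebra_preimageType X)) U ->
  measurable_fun setT U.
Proof.
by move=> mX mU; exact: measurableT_comp mU (measurable_id_preimage mX).
Qed.

(** By independence the joint law of [X] and [Z] is the product of their laws, and Tonelli's theorem
    factors the integral. *)
Lemma ge0_integralM_independent d d' d'' (T : measurableType d)
    (R : realType) (P : probability T R) (T' : measurableType d')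
    (T'' : measurableType d'')
    (X : T -> T') (Z : T -> T'') (Q : probability T'' R)
    (U : T' -> R) (h : T'' -> R) :
  measurable_fun setT X -> measurable_fun setT Z ->
  (forall E, measurable E -> P (Z @^-1` E) = Q E) ->
  independent_rv P Z X ->
  measurable_fun setT U -> measurable_fun setT h ->
  (forall w, 0 <= U w) -> (forall z, 0 <= h z) ->
  (\int[P]_w (U (X w) * h (Z w))%:E =
   \int[P]_w (U (X w))%:E * \int[Q]_z (h z)%:E)%E.
Proof.
move=> mX mZ lawZ indep mU mh U0 h0.
pose Xm : {mfun T >-> T'} :=
  HB.pack X (isMeasurableFun.Build _ _ _ _ _ mX).
have mXZ : measurable_fun setT (fun w => (X w, Z w)).
  exact: measurable_fun_pair.
pose XZm : {mfun T >-> (T' * T'')%type} :=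
  HB.pack (fun w => (X w, Z w)) (isMeasurableFun.Build _ _ _ _ _ mXZ).
pose PX : probability T' R := distribution P Xm.
pose PXZ : probability (T' * T'')%type R := distribution P XZm.
(* Independence gives agreement on rectangles, which determines the product measure. *)
have E A : measurable A -> (PX \x Q)%E A = PXZ A.
  apply: product_measure_unique => B C mB mC.
  rewrite /PXZ /PX /distribution /pushforward /=.
  by rewrite -lawZ// muleC -indep// setIC.
pose g (z : T' * T'') := (U z.1 * h z.2)%:E.
have mg : measurable_fun setT g.
  apply/measurable_EFinP; apply: measurable_funM; exact: measurableT_comp.
have mUE : measurable_fun setT (EFin \o U) by exact/measurable_EFinP.
have mhE : measurable_fun setT (EFin \o h) by exact/measurable_EFinP.
transitivity (\int[PXZ]_z g z)%E.
  by rewrite ge0_integral_pushforward// => z _; rewrite lee_fin mulr_ge0.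
transitivity (\int[PX \x Q]_z g z)%E.
  apply: eq_measure_integral => A mA _; first [exact: E|exact/esym/E].
rewrite fubini_tonelli1//; last by move=> z; rewrite lee_fin mulr_ge0.
rewrite /fubini_F /g /=.
under eq_integral do under eq_integral do rewrite EFinM.
under eq_integral => w _.
  rewrite ge0_integralZl//; [|by move=> z _; rewrite lee_fin|by rewrite lee_fin].
  over.
rewrite /= ge0_integralZr//.
- by congr (_ * _)%E; rewrite ge0_integral_pushforward// => z _; rewrite lee_fin.
- by move=> z _; rewrite lee_fin.
- by apply: integral_ge0 => z _; rewrite lee_fin.
Qed.

(** Both laws have unit variance, so the peaks cancel and only the exponential tilt remains. *)
Lemma normal_lr_mean (R : realType) (a z : R) :
  normal_lr a 1 z = expR (a * z - a ^+ 2 / 2).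
Proof.
rewrite /normal_lr !normal_pdfE ?oner_neq0// -mulf_div divff ?mul1r; last first.
  by rewrite gt_eqF// normal_peak_gt0 ?oner_neq0.
by rewrite /normal_fun -expRN -expRD; congr expR; field.
Qed.

(** The ratio of the normalizing constants is [s^-1], which gives the term [- ln s]. *)
Lemma normal_lr_scale (R : realType) (s z : R) : 0 < s ->
  normal_lr 0 s z = expR ((1 - (s ^+ 2)^-1) / 2 * z ^+ 2 - ln s).
Proof.
move=> s0; have sN0 : s != 0 by rewrite gt_eqF.
rewrite /normal_lr !normal_pdfE ?oner_neq0// -mulf_div.
have -> : normal_peak s / normal_peak 1 = expR (- ln s).
  rewrite /normal_peak expRN lnK ?posrE// invrK expr1n mul1r -mulrnAr.
  have p0 : 0 < @pi R *+ 2 by rewrite mulrn_wgt0// pi_gt0.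
  rewrite sqrtrM ?sqr_ge0// sqrtr_sqr gtr0_norm// invfM mulfVK//.
  by rewrite gt_eqF// sqrtr_gt0.
by rewrite /normal_fun -expRN -!expRD; congr expR; field; rewrite sN0.
Qed.

(** Strictness makes the exponential rate in [square_one_sided] positive. *)
Lemma ln_lt_subr1 (R : realType) (x : R) : 0 < x -> x != 1 -> ln x < x - 1.
Proof.
move=> x0 x1; have : ln x != 0 by rewrite ln_eq0.
by move=> /expR_gt1Dx; rewrite lnK ?posrE// ltrBrDl.
Qed.

(** * Sums of standardized errors over predictably selected runs *)

Section selected_runs.
Context dO (Omega : measurableType dO) (R : realType) (P : probability Omega R).
Context d' (T' : nat -> measurableType d') (X : forall t, Omega -> T' t).
Variables (Z : nat -> Omega -> R) (hit : nat -> nat -> Omega -> bool).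
Hypothesis mX : forall t, measurable_fun setT (X t).
Hypothesis mZ : forall i, measurable_fun setT (Z i).
Hypothesis lawZ : forall i E, measurable E ->
  P (Z i @^-1` E) = normal_prob 0 1 E.
Hypothesis indep : forall i, independent_rv P (Z i) (X i).
Hypothesis adaptedZ : forall i t, (i < t)%N ->
  measurable_fun (setT : set (g_sigma_algebra_preimageType (X t))) (Z i).
Hypothesis adapted_hit : forall m i t, (i <= t)%N ->
  measurable_fun (setT : set (g_sigma_algebra_preimageType (X t))) (hit m i).

Definition hits (m t : nat) (w : Omega) : nat := \sum_(i < t) hit m i w.

(** [hits m i] counts only runs before [i], so this is decided by [X i], before [Z i] is revealed,
    and at most [m] runs are ever selected. *)
Definition selected (m i : nat) (w : Omega) : bool :=
  hit m i w && (hits m i w < m)%N.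

(** For [s != 0], a nonnegative martingale in [t] with mean 1. *)
Definition lr_product (a s : R) (m t : nat) (w : Omega) : R :=
  \prod_(i < t | selected m i w) normal_lr a s (Z i w).

Let adapted_hits m i t : (i <= t)%N ->
  measurable_fun (setT : set (g_sigma_algebra_preimageType (X t))) (hits m i).
Proof.
elim: i => [|i IH] it.
  by rewrite (_ : hits m 0 = cst 0%N)//; apply/funext => w; rewrite /hits big_ord0.
rewrite (_ : hits m i.+1 = fun w => (hits m i w + hit m i w)%N); last first.
  by apply/funext => w; rewrite /hits big_ord_recr.
apply: measurable_fun_addn; first exact/IH/ltnW.
rewrite (_ : (fun _ => _) = (fun w => if hit m i w then 1%N else 0%N)); last first.
  by apply/funext => w; case: hit.
by apply: measurable_fun_ifT => //; exact/adapted_hit/ltnW.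
Qed.

Let adapted_selected m i t : (i <= t)%N ->
  measurable_fun (setT : set (g_sigma_algebra_preimageType (X t))) (selected m i).
Proof.
move=> it; apply: measurable_and; first exact: adapted_hit.
by apply: measurable_fun_ltn => //; exact: adapted_hits.
Qed.

Let adapted_lr_product a s m i t : (i <= t)%N ->
  measurable_fun (setT : set (g_sigma_algebra_preimageType (X t)))
    (lr_product a s m i).
Proof.
elim: i => [|i IH] it.
  by rewrite (_ : lr_product a s m 0 = cst 1)//; apply/funext => w;
    rewrite /lr_product big_ord0.
rewrite (_ : lr_product a s m i.+1 = fun w => lr_product a s m i w *
    if selected m i w then normal_lr a s (Z i w) else 1); last first.
  by apply/funext => w; rewrite /lr_product big_mkcond big_ord_recr -big_mkcond.
apply: measurable_funM; first exact/IH/ltnW.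
apply: measurable_fun_ifT => //; first exact/adapted_selected/ltnW.
exact: measurableT_comp (measurable_normal_lr _ _) (adaptedZ _).
Qed.

Let lr_product_ge0 a s m t w : 0 <= lr_product a s m t w.
Proof. by apply: prodr_ge0 => i _; exact: normal_lr_ge0. Qed.

Let measurable_of_adapted d2 (T2 : measurableType d2) t (U : Omega -> T2) :
  measurable_fun (setT : set (g_sigma_algebra_preimageType (X t))) U ->
  measurable_fun setT U.
Proof. by apply: measurable_preimageType_comp; exact: mX. Qed.

(** Induction on [t]: where run [t] is selected, the new factor is independent of [X t], which
    determines the product so far, and has mean 1; elsewhere nothing changes. *)
Lemma integral_lr_product a s m t : s != 0 ->
  (\int[P]_w (lr_product a s m t w)%:E = 1)%E.
Proof.
move=> s0; elim: t => [|t IH].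
  under eq_integral do rewrite /lr_product big_ord0.
  rewrite integral_cst// mul1e; exact: probability_setT.
(* [Omega] with the sigma-algebra generated by [X t]: its identity map serves as the variable
   independent of [Z t]. [U0] and [U1] split the product according to whether run [t] is
   selected. *)
pose T0 : measurableType _ := g_sigma_algebra_preimageType (X t).
pose U0 (w : T0) : R := if selected m t w then 0 else lr_product a s m t w.
pose U1 (w : T0) : R := if selected m t w then lr_product a s m t w else 0.
have mU0 : measurable_fun setT U0.
  by apply: measurable_fun_ifT => //;
    [exact: adapted_selected|exact: adapted_lr_product].
have mU1 : measurable_fun setT U1.
  by apply: measurable_fun_ifT => //;
    [exact: adapted_selected|exact: adapted_lr_product].
have U0ge0 w : 0 <= U0 w by rewrite /U0; case: ifP.
have U1ge0 w : 0 <= U1 w by rewrite /U1; case: ifP.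
have mU0' : @measurable_fun _ _ Omega R setT U0 by exact: measurable_of_adapted mU0.
have mU1' : @measurable_fun _ _ Omega R setT U1 by exact: measurable_of_adapted mU1.
have mh := measurable_normal_lr a s.
transitivity (\int[P]_w ((U0 w)%:E + (U1 w * normal_lr a s (Z t w))%:E))%E.
  apply: eq_integral => w _; rewrite -EFinD; congr (_%:E).
  rewrite /lr_product big_mkcond big_ord_recr -big_mkcond /= /U0 /U1.
  by case: ifP => _; rewrite ?mulr1 ?mul0r ?add0r ?addr0.
have mE0 : @measurable_fun _ _ Omega (\bar R) setT (EFin \o U0) by exact/measurable_EFinP.
have mE1 : @measurable_fun _ _ Omega (\bar R) setT (EFin \o U1) by exact/measurable_EFinP.
rewrite ge0_integralD//; last 3 first.
- by move=> w _; rewrite lee_fin.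
- by move=> w _; rewrite lee_fin mulr_ge0// normal_lr_ge0.
- apply/measurable_EFinP; apply: measurable_funM => //.
  exact: measurableT_comp.
have -> : (\int[P]_w (U1 w * normal_lr a s (Z t w))%:E = \int[P]_w (U1 w)%:E)%E.
  rewrite (ge0_integralM_independent (Q := normal_prob 0 1) (T := Omega) (T' := T0)
    (measurable_id_preimage (@mX t)) (@mZ t) (@lawZ t) _ mU1 mh)//.
  - by rewrite integral_normal_lr// mule1.
  - by move=> A B mA [C mC <-]; rewrite setTI; exact: indep.
  - exact: normal_lr_ge0.
rewrite -ge0_integralD//; last 2 first.
- by move=> w _; rewrite lee_fin.
- by move=> w _; rewrite lee_fin.
rewrite -[RHS]IH; apply: eq_integral => w _.
by rewrite -EFinD /U0 /U1; case: ifP => _; rewrite ?add0r ?addr0.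
Qed.

Let measurable_lr_product a s m t : measurable_fun setT (lr_product a s m t).
Proof. by apply: (@measurable_of_adapted _ _ t); exact: adapted_lr_product. Qed.

Let measurable_hits m t : measurable_fun setT (hits m t).
Proof. by apply: (@measurable_of_adapted _ _ t); exact: adapted_hits. Qed.

(** * Exponential bounds uniform in the stage *)

Lemma lr_product_markov a s m t (K : R) : s != 0 -> 0 < K ->
  (P [set w | (K <= lr_product a s m t w)%R] <= K^-1%:E)%E.
Proof.
move=> s0 K0.
have mE : measurable_fun setT (EFin \o lr_product a s m t) by exact/measurable_EFinP.
have := le_integral_abse P measurableT mE K0.
under eq_integral do rewrite /= ger0_norm//.
rewrite integral_lr_product// setTI.
rewrite (_ : [set _ | _] = [set w | K <= lr_product a s m t w]); last first.
  by apply/seteqP; split => w /=; rewrite lee_fin ger0_norm.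
rewrite -lee_pdivlMl//.
by rewrite mule1.
Qed.

(** Requiring [m] hits freezes the product: no run is selected after the [m]-th hit, so these events
    increase with [t]. *)
Let deviation a s (delta : R) (m t : nat) : set Omega :=
  [set w | (m <= hits m t w)%N /\ expR (m%:R * delta) <= lr_product a s m t w].

Let measurable_deviation a s delta m t : measurable (deviation a s delta m t).
Proof.
rewrite (_ : deviation _ _ _ _ _ = (hits m t @^-1` [set n | m <= n]%N) `&`
  (lr_product a s m t @^-1` `[expR (m%:R * delta), +oo[)); last first.
  by apply/seteqP; split => w /=; rewrite in_itv/= andbT.
apply: measurableI; rewrite -[X in measurable X]setTI.
- exact: measurable_hits.
- by apply: measurable_lr_product => //; exact: measurable_itv.
Qed.

Let nondecreasing_deviation a s delta m :
  nondecreasing_seq (deviation a s delta m).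
Proof.
apply/nondecreasing_seqP => t; apply/subsetPset => w [mt le].
have hS : hits m t.+1 w = (hits m t w + hit m t w)%N.
  by rewrite /hits big_ord_recr.
split; first by rewrite hS (leq_trans mt)// leq_addr.
rewrite (le_trans le)// /lr_product [leRHS]big_mkcond big_ord_recr -big_mkcond /=.
by rewrite /selected ltnNge mt andbF mulr1.
Qed.

(** Markov's inequality bounds each deviation by [expR (- delta) ^+ m]. Continuity from below
    carries the bound to the union over all stages, and Borel-Cantelli applies to the resulting
    geometric series. *)
Lemma lr_product_eventually a s (delta : R) : s != 0 -> 0 < delta ->
  {ae P, forall w, exists N, forall m t, (N <= m)%N -> (m <= hits m t w)%N ->
    lr_product a s m t w < expR (m%:R * delta)}.
Proof.
move=> s0 d0; pose F m := \bigcup_t deviation a s delta m t.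
have mF m : measurable (F m) by apply: bigcupT_measurable.
have PF m : (P (F m) <= (expR (- delta) ^+ m)%:E)%E.
  have /cvg_lim <-// := nondecreasing_cvg_mu (mu := P)
    (measurable_deviation a s delta m) (mF m) (@nondecreasing_deviation a s delta m).
  apply: lime_le.
    apply: ereal_nondecreasing_is_cvgn => i j ij.
    by rewrite le_measure ?inE//; exact/subsetPset/nondecreasing_deviation.
  apply: nearW => t; apply: (@le_trans _ _
      (P [set w | expR (m%:R * delta) <= lr_product a s m t w]%R)).
    rewrite le_measure ?inE//; last by move=> w [].
    rewrite (_ : [set _ | _] = lr_product a s m t @^-1` `[expR (m%:R * delta), +oo[).
      by rewrite -[X in measurable X]setTI; apply: measurable_lr_product;
        [exact: measurableT|exact: measurable_itv].
    by apply/seteqP; split => w /=; rewrite in_itv/= andbT.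
  apply: (le_trans (lr_product_markov _ _ _ _ _)) => //; first exact: expR_gt0.
  by rewrite lee_fin -expRN -expRM_natl mulrN.
have sumF : (\sum_(m <oo) P (F m) < +oo)%E.
  apply: (@le_lt_trans _ _ (\sum_(m <oo) (expR (- delta) ^+ m)%:E)%E).
    by apply: lee_nneseries => // m _.
  rewrite (_ : (fun n => _) = EFin \o series (geometric 1 (expR (- delta)))).
    rewrite EFin_lim ?ltry//.
    by apply: is_cvg_geometric_series; rewrite ger0_norm ?expR_ge0// expR_lt1 oppr_lt0.
  apply/funext => n /=; rewrite /series /= sumEFin; congr (_%:E).
  by apply: eq_bigr => i _; rewrite mul1r.
have null := lim_sup_set_cvg0 mF sumF.
exists (lim_sup_set F); split => //.
  by apply: bigcap_measurable => // n _; apply: bigcup_measurable.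
move=> w nw n _; apply: contrapT => nF; apply: nw; exists n => m t nm mt.
rewrite ltNge; apply/negP => le; apply: nF; exists m => //.
by exists t.
Qed.

(** * One-sided and two-sided deviation bounds *)

(* [Z i] enters the product only while fewer than [m] runs were selected, which is
   automatic for all hits when there are exactly [m] of them. *)
Lemma lr_product_hits a s m t w : hits m t w = m ->
  lr_product a s m t w = \prod_(i < t | hit m i w) normal_lr a s (Z i w).
Proof.
move=> hm; apply: eq_bigl => i; rewrite /selected.
have [hi|//] := boolP (hit m i w); rewrite -[X in (_ < X)%N]hm.
have -> : hits m t w = (hits m i w + \sum_(i <= j < t) hit m j w)%N.
  by rewrite /hits -!(big_mkord predT (fun i => hit m i w : nat))
    -big_cat_nat// ltnW.
by rewrite big_ltn// hi addnA ltn_addr// addn1.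
Qed.

Lemma prod_expR_hits (q : R -> R) (b : R) m t w : hits m t w = m ->
  \prod_(i < t | hit m i w) expR (q (Z i w) - b) =
  expR (\sum_(i < t | hit m i w) q (Z i w) - m%:R * b).
Proof.
move=> hm; rewrite -expR_sum; congr expR; rewrite big_split/= sumrN.
congr (_ - _); rewrite sumr_const -[LHS]mulr_natl; congr (_%:R * _).
rewrite -[RHS]hm /hits -sum1_card big_mkcond; apply: eq_bigr => i _.
by rewrite unfold_in; case: hit.
Qed.

(** The sign of [a] chooses the side of the bound. The rate [a ^+ 2 / 2] doubles the compensator
    [a ^+ 2 / 2] in the exponent of the likelihood ratio. *)
Lemma mean_one_sided (a : R) : a != 0 ->
  {ae P, forall w, exists N, forall m t, (N <= m)%N -> hits m t w = m ->
    a * \sum_(i < t | hit m i w) Z i w < m%:R * a ^+ 2}.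
Proof.
move=> a0; have d0 : 0 < a ^+ 2 / 2 by rewrite divr_gt0// exprn_even_gt0.
apply: filterS (lr_product_eventually a (oner_neq0 R) d0) => w [N HN].
exists N => m t Nm hm; have := HN m t Nm; rewrite hm leqnn => /(_ isT).
rewrite lr_product_hits//; under eq_bigr do rewrite normal_lr_mean.
rewrite (prod_expR_hits (fun z => a * z))// ltr_expR -mulr_sumr.
by rewrite ltrBlDr -mulrDr -splitr.
Qed.

(** An upper bound on the sum of squares for [s > 1] and a lower one for [s < 1], both with
    threshold [m * s ^+ 2]. *)
Lemma square_one_sided (s : R) : 0 < s -> s ^+ 2 != 1 ->
  {ae P, forall w, exists N, forall m t, (N <= m)%N -> hits m t w = m ->
    (s ^+ 2 - 1) * \sum_(i < t | hit m i w) Z i w ^+ 2 <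
    m%:R * ((s ^+ 2 - 1) * s ^+ 2)}.
Proof.
move=> s0 s1; have sN0 : s != 0 by rewrite gt_eqF.
(* This rate cancels the [ln s] of the likelihood ratio; it is positive because [ln u < u - 1] at
   [u = s ^+ 2]. *)
have d0 : 0 < (s ^+ 2 - 1) / 2 - ln s.
  rewrite subr_gt0 ltr_pdivlMr// mulr_natr -lnXn//.
  by rewrite ln_lt_subr1// exprn_gt0.
apply: filterS (lr_product_eventually 0 sN0 d0) => w [N HN].
exists N => m t Nm hm; have := HN m t Nm; rewrite hm leqnn => /(_ isT).
rewrite lr_product_hits//; under eq_bigr do rewrite normal_lr_scale//.
rewrite (prod_expR_hits (fun z => (1 - (s ^+ 2)^-1) / 2 * z ^+ 2))// ltr_expR.
rewrite -mulr_sumr ltrBlDr -mulrDr subrK.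
set S := \sum_(_ < _ | _) _ => h.
have s2 : 0 < s ^+ 2 * 2 by rewrite mulr_gt0// exprn_gt0.
move: h; rewrite -(ltr_pM2l s2).
by congr (_ < _); field.
Qed.

(** Four one-sided bounds: means [e] and [- e], variances [1 + e] and [1 - e]. The bound [e < 1]
    keeps the last variance positive. *)
Lemma sums_concentrate (e : R) : 0 < e < 1 ->
  {ae P, forall w, exists N, forall m t, (N <= m)%N -> hits m t w = m ->
    `|\sum_(i < t | hit m i w) Z i w| <= m%:R * e /\
    `|\sum_(i < t | hit m i w) Z i w ^+ 2 - m%:R| <= m%:R * e}.
Proof.
move=> /andP[e0 e1]; have eN0 : e != 0 by rewrite gt_eqF.
have p0 : 0 < 1 + e by rewrite addr_gt0.
have q0 : 0 < 1 - e by rewrite subr_gt0.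
have sp : Num.sqrt (1 + e) ^+ 2 = 1 + e by rewrite sqr_sqrtr// ltW.
have sq : Num.sqrt (1 - e) ^+ 2 = 1 - e by rewrite sqr_sqrtr// ltW.
have H1 := mean_one_sided eN0.
have H2 : {ae P, forall w, exists N, forall m t, (N <= m)%N -> hits m t w = m ->
    - e * \sum_(i < t | hit m i w) Z i w < m%:R * (- e) ^+ 2}.
  by apply: mean_one_sided; rewrite oppr_eq0.
have H3 := @square_one_sided (Num.sqrt (1 + e)).
have H4 := @square_one_sided (Num.sqrt (1 - e)).
rewrite sp sqrtr_gt0 p0 addrAC subrr add0r in H3.
rewrite sq sqrtr_gt0 q0 addrAC subrr add0r in H4.
have p1 : 1 + e != 1 by rewrite -subr_eq0 addrAC subrr add0r.
have q1 : 1 - e != 1 by rewrite -subr_eq0 addrAC subrr add0r oppr_eq0.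
apply: filterS2 (filterI H1 H2) (filterI (H3 isT p1) (H4 isT q1)).
move=> w [[N1 h1] [N2 h2]] [[N3 h3] [N4 h4]].
exists (maxn (maxn N1 N2) (maxn N3 N4)) => m t; rewrite !geq_max.
move=> /andP[/andP[n1 n2] /andP[n3 n4]] hm.
have {}h1 := h1 m t n1 hm; have {}h2 := h2 m t n2 hm.
have {}h3 := h3 m t n3 hm; have {}h4 := h4 m t n4 hm.
rewrite !ler_norml; split; apply/andP; split; apply/ltW.
- rewrite -(ltr_pM2l e0); lra.
- rewrite -(ltr_pM2l e0); lra.
- rewrite -(ltr_pM2l e0); lra.
- rewrite -(ltr_pM2l e0); lra.
Qed.

End selected_runs.

(** * Borel sets of row vectors and recurrence *)

(** Balls of the sup norm are coordinate boxes. *)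
Lemma rV_nbhs_box (R : realType) (d : nat) (v : 'rV[R]_d) (U : set 'rV[R]_d) :
  nbhs v U <->
  exists2 e : R, 0 < e & forall w : 'rV[R]_d,
    (forall i, `|v ord0 i - w ord0 i| < e) -> U w.
Proof.
split=> [/nbhs_ballP[e /= e0 eU]|[e e0 eU]].
  exists e => // w vw; apply: eU; split => // i j.
  by rewrite (ord1 i); exact: vw.
by apply/nbhs_ballP; exists e => //= w [_ vw]; apply: eU => i; exact: (vw ord0 i).
Qed.

(** An open set is the union of the countably many boxes with rational center and half-side
    [k.+1%:R^-1] that it contains. *)
Lemma open_measurable_rV (R : realType) (d : nat) (U : set 'rV[R]_d) :
  open U -> measurable U.
Proof.
move=> oU.
have aux1 (x z h : R) : x - h < z < x + h -> z - h < x <= z + h by lra.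
have aux2 (x z h e w : R) : h < e / 2 ->
  x - h < z < x + h -> z - h < w <= z + h -> - e < x - w < e by lra.
pose B (q : 'rV[rat]_d * nat) : set 'rV[R]_d := [set v | forall i,
  v ord0 i \in `](ratr (q.1 ord0 i) - q.2.+1%:R^-1), (ratr (q.1 ord0 i) + q.2.+1%:R^-1)] ].
pose F (n : nat) : set 'rV[R]_d :=
  if unpickle n is Some q then (if `[< B q `<=` U >] then B q else set0) else set0.
rewrite (_ : U = \bigcup_n F n); last first.
  apply/seteqP; split => [v Uv|v [n _]]; last first.
    by rewrite /F; case: unpickle => // q; case: asboolP => // + Bv; exact.
  have : nbhs v U by exact: open_nbhs_nbhs.
  move=> /rV_nbhs_box[e e0 eU].
  (* Half of [e], since two points of one box are compared through its center. *)
  have [k ke] : exists k, (k.+1%:R^-1 : R) < e / 2.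
    have /ltr_add_invr[k] : (0 : R) < e / 2 by rewrite divr_gt0.
    by rewrite add0r; exists k.
  have k0 : 0 < k.+1%:R^-1 :> R by rewrite invr_gt0.
  have /choice[q Hq] : forall i, exists q : rat,
      ratr q \in `](v ord0 i - k.+1%:R^-1), (v ord0 i + k.+1%:R^-1)[.
    move=> i; apply: rat_in_itvoo; by rewrite ltrD2l gtrN.
  pose qk : 'rV[rat]_d * nat := (\row_i q i, k).
  exists (pickle qk) => //; rewrite /F pickleK.
  case: asboolP => [_|].
    by move=> i /=; rewrite mxE; have := Hq i; rewrite !in_itv/=; exact: aux1.
  case=> w Bw; apply: eU => i; have := Bw i; have := Hq i; move: ke.
  by rewrite /= mxE !in_itv/= ltr_norml; exact: aux2.
apply: bigcupT_measurable => n; rewrite /F; case: unpickle => // q.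
by case: asboolP => // _; exact: measurable_rV_box.
Qed.

Lemma enorm_le (R : realType) (d : nat) (u : 'rV[R]_d) (e : R) : 0 <= e ->
  (forall i, `|u ord0 i| <= e) -> enorm u <= Num.sqrt d%:R * e.
Proof.
move=> e0 ue; rewrite /enorm -[in leRHS](ger0_norm e0) -sqrtr_sqr -sqrtrM ?ler0n//.
apply: ler_wsqrtr; rewrite mulr_natl.
rewrite -[X in _ *+ X]card_ord -sumr_const; apply: ler_sum => i _.
by rewrite -[leLHS]real_normK ?num_real// lerXn2r// nnegrE.
Qed.

Lemma measurable_enorm_sub (R : realType) (d : nat) (y : 'rV[R]_d) :
  measurable_fun setT (fun v : 'rV[R]_d => enorm (v - y)).
Proof.
apply: (@measurableT_comp _ _ _ _ _ _ (@Num.sqrt R)).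
  exact: continuous_measurable_fun (@sqrt_continuous R).
apply: measurable_sum => i; apply: measurable_funX.
under eq_fun do rewrite !mxE.
by apply: measurable_funB => //; exact: measurable_coord.
Qed.

Lemma enorm_ge0 (R : realType) (d : nat) (u : 'rV[R]_d) : 0 <= enorm u.
Proof. exact: sqrtr_ge0. Qed.

(** Lipschitz continuity makes the preimage in the interior of an open interval open, and open
    intervals generate the Borel sets. *)
Lemma elipschitz_measurable (R : realType) (d : nat) (L : R) (A : set 'rV[R]_d)
    (g : 'rV[R]_d -> R) : 0 < L ->
  elipschitz_on L A g -> measurable_fun A° g.
Proof.
move=> L0 lip; apply: (measurability _ (RGenOpens.measurableE R)).
move=> _ [_ [a [b ->] <-]]; apply: open_measurable_rV.
rewrite openE => v [Av]; rewrite /= in_itv/= => /andP[av vb].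
apply: filterI; first exact: open_nbhs_nbhs (conj (@open_interior _ _) Av).
move: (Av) => /rV_nbhs_box[e e0 eA].
have C0 : 0 < L * (Num.sqrt d%:R + 1).
  by rewrite mulr_gt0// ltr_wpDl.
pose del := Num.min (g v - a) (b - g v).
have del0 : 0 < del by rewrite lt_min !subr_gt0 av vb.
(* Passing from the sup norm to the Euclidean one costs a factor [Num.sqrt d%:R]; the added 1 makes
   the final inequality strict. *)
apply/rV_nbhs_box; exists (Num.min e (del / (L * (Num.sqrt d%:R + 1)))).
  by rewrite lt_min e0 divr_gt0.
move=> w vw.
have Aw : A w by apply: eA => i; have := vw i; rewrite lt_min => /andP[].
have : `|g v - g w| < del.
  apply: (le_lt_trans (lip _ _ (interior_subset Av) Aw)).
  rewrite -ltr_pdivlMl//.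
  apply: (@le_lt_trans _ _ (Num.sqrt d%:R * (del / (L * (Num.sqrt d%:R + 1))))).
    apply: enorm_le => [|i]; first by rewrite divr_ge0// ltW.
    by rewrite !mxE; have := vw i; rewrite lt_min => /andP[_ /ltW].
  rewrite invfM mulrCA [ltRHS]mulrC ltr_pM2l// mulrCA gtr_pMr ?invr_gt0//.
  by rewrite ltr_pdivrMr ?ltr_wpDl// mul1r ltrDl.
by rewrite /del /= in_itv/= lt_min !ltr_norml; lra.
Qed.

Lemma box_in_ball (R : realType) (d : nat) (Y : set 'rV[R]_d) (y : 'rV[R]_d)
    (r : R) : Y° y -> 0 < r ->
  exists2 Q : set 'rV[R]_d, measurable Q &
    [/\ Q `<=` Y°, forall v, Q v -> enorm (v - y) < r
      & exists2 l : R, 0 < l & lebesgue_rV R d Q = l%:E].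
Proof.
move=> Yy r0.
have : nbhs y Y° by exact: open_nbhs_nbhs (conj (@open_interior _ _) Yy).
move=> /rV_nbhs_box[e e0 eY].
have C0 : 0 < Num.sqrt d%:R + 1 :> R by rewrite ltr_wpDl.
(* The first bound keeps the box inside the interior of [Y], the second inside the Euclidean
   ball. *)
pose h := Num.min (e / 2) (r / (Num.sqrt d%:R + 1)).
have h0 : 0 < h by rewrite lt_min !divr_gt0.
exists [set v | forall i, v ord0 i \in `](y ord0 i - h), (y ord0 i + h)] ].
  exact: measurable_rV_box.
split => [v Qv|v Qv|].
- apply: eY => i; have := Qv i; rewrite in_itv/= ltr_norml.
  have : h <= e / 2 by rewrite ge_min lexx.
  move: e0; lra.
- apply: (@le_lt_trans _ _ (Num.sqrt d%:R * h)).
    apply: enorm_le => [|i]; first exact: ltW.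
    by have := Qv i; rewrite !mxE in_itv/= ler_norml; lra.
  apply: (@lt_le_trans _ _ ((Num.sqrt d%:R + 1) * h)).
    by rewrite ltr_pM2r// ltrDl.
  by rewrite -ler_pdivlMl// mulrC ge_min lexx orbT.
- exists (\prod_(i < d) ((y ord0 i + h) - (y ord0 i - h))).
    by apply: prodr_gt0 => i _; move: h0; lra.
  by rewrite lebesgue_rV_box// => i; move: h0; lra.
Qed.

(** A conditional second Borel-Cantelli lemma: each further stage multiplies the probability of
    having had no event since stage [k] by at most [1 - q]. *)
Lemma infinitely_often (dO : measure_display) (Omega : measurableType dO)
    (R : realType) (P : probability Omega R) (E : nat -> set Omega) (q : R) :
  (forall i, measurable (E i)) -> 0 < q ->
  (forall k n, (q%:E * P (\bigcap_(j in [set j | (k <= j < k + n)%N]) ~` E j) <=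
     P ((\bigcap_(j in [set j | (k <= j < k + n)%N]) ~` E j) `&` E (k + n)%N))%E) ->
  {ae P, forall w, forall k, exists2 i, (k <= i)%N & E i w}.
Proof.
move=> mE q0 H; apply: ae_foralln => k.
pose M n := \bigcap_(j in [set j | (k <= j < k + n)%N]) ~` E j.
have mM n : measurable (M n).
  by apply: bigcap_measurableType => j _; exact: measurableC.
have fin A : measurable A -> P A \is a fin_num by move=> mA; exact: fin_num_measure.
have step n : fine (P (M n.+1)) <= (1 - q) * fine (P (M n)).
  have -> : M n.+1 = M n `\` E (k + n)%N.
    apply/seteqP; split=> [w Mw|w [Mw Ew] j /= /andP[kj]].
      split=> [j /andP[kj jn]|]; last by apply: Mw => /=; rewrite leq_addr addnS/=.
      by apply: Mw => /=; rewrite kj addnS ltnS ltnW.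
    rewrite addnS ltnS leq_eqVlt => /orP[/eqP->//|jn]; apply: Mw => /=.
    by rewrite kj.
  rewrite measureD//; last by rewrite ltey_eq fin.
  rewrite fineB ?fin//; last exact: measurableI.
  rewrite mulrBl mul1r lerD2l lerN2.
  rewrite -lee_fin EFinM !fineK ?fin//; last exact: measurableI.
  exact: H.
have bound n : fine (P (M n)) <= (1 - q) ^+ n.
  (* This follows from [step] at 0, because [M 0] is the whole space. *)
  have q1 : 0 <= 1 - q.
    have := step 0%N; have -> : M 0 = setT.
      by apply/seteqP; split => // w _ j /=; rewrite addn0 => /andP[kj]; rewrite ltnNge kj.
    rewrite probability_setT mulr1; apply: le_trans; exact: fine_ge0.
  elim: n => [|n IH]; last first.
    by rewrite (le_trans (step n))// exprS ler_wpM2l.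
  by rewrite expr0 -lee_fin fineK ?fin// probability_le1.
have PN : P (\bigcap_n M n) = 0%E.
  apply/eqP; rewrite eq_le measure_ge0 andbT.
  have mI : measurable (\bigcap_n M n) by exact: bigcap_measurableType.
  have le n : fine (P (\bigcap_n M n)) <= (1 - q) ^+ n.
    apply: le_trans (bound n); rewrite fine_le ?fin// le_measure ?inE//.
    by move=> w Mw; exact: (Mw n).
  rewrite -[leLHS]fineK ?fin// lee_fin.
  (* For [q < 1] the geometric bound tends to 0; otherwise the bound at [n = 1] is already
     nonpositive. *)
  have [q1|q1] := ltP q 1.
    have : `|1 - q| < 1 by rewrite gtr0_norm ?subr_gt0// gtrDl oppr_lt0.
    move=> /cvg_expr cvq; apply: (cvgr_to_ge cvq).
    exact: nearW.
  by rewrite (le_trans (le 1%N))// expr1 subr_le0.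
exists (\bigcap_n M n); split => //; first exact: bigcap_measurableType.
move=> w /= nw n _ j /= /andP[kj _] Ej; apply: nw; exists j => //.
Qed.

(** * Convergence of the estimators along one path *)

Lemma cvg_dist_bound (R : realType) (u v w : nat -> R) (l : R) :
  (\forall t \near \oo, `|u t - v t| <= w t) ->
  w @ \oo --> (0 : R) -> v @ \oo --> l -> u @ \oo --> l.
Proof.
move=> uvw w0 vl.
have h : (fun t => u t - v t) @ \oo --> (0 : R).
  apply/norm_cvg0P; apply: (squeeze_cvgr _ (cvg_cst 0) w0).
  by apply: filterS uvw => t h; rewrite normr_ge0 h.
have H := cvgD h vl; rewrite add0r in H.
suff -> : u = (fun t => u t - v t) \+ v by exact: H.
by apply/funext => t /=; rewrite subrK.
Qed.

Lemma cvg_near_eq (R : realType) (u v : nat -> R) (l : R) :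
  (\forall t \near \oo, u t = v t) -> v @ \oo --> l -> u @ \oo --> l.
Proof.
move=> uv; apply: cvg_trans; apply: near_eq_cvg.
by apply: filterS uv => t ->.
Qed.

(** * Averages over a sequence of indices *)

Definition average (R : realType) (s : seq nat) (F : nat -> R) : R :=
  (size s)%:R^-1 * \sum_(i <- s) F i.

Lemma averageD (R : realType) (s : seq nat) (F G : nat -> R) :
  average s (fun i => F i + G i) = average s F + average s G.
Proof. by rewrite /average big_split mulrDr. Qed.

Lemma averageZ (R : realType) (s : seq nat) (k : R) (F : nat -> R) :
  average s (fun i => k * F i) = k * average s F.
Proof. by rewrite /average -mulr_sumr mulrCA. Qed.

Lemma average_cst (R : realType) (s : seq nat) (k : R) : (0 < size s)%N ->
  average s (fun=> k) = k.
Proof.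
move=> s0; rewrite /average big_const_seq count_predT iter_addr_0 -[k *+ _]mulr_natl.
by rewrite mulKf// pnatr_eq0 -lt0n.
Qed.

Lemma average_dist_le (R : realType) (s : seq nat) (F G H : nat -> R) :
  (forall i, i \in s -> `|F i - G i| <= H i) ->
  `|average s F - average s G| <= average s H.
Proof.
move=> FGH; rewrite /average -mulrBr -sumrB normrM ger0_norm ?invr_ge0 ?ler0n//.
rewrite ler_wpM2l ?invr_ge0 ?ler0n// (le_trans (ler_norm_sum _ _ _))//.
by rewrite big_seq [leRHS]big_seq; apply: ler_sum.
Qed.

(** * Neighborhoods and activation along a path *)

Section path.
Context (R : realType) (d : nat) (chi : finType).
Variables (c xi : R) (Y : set 'rV[R]_d).
Variables (xs : nat -> chi) (ys : nat -> 'rV[R]_d) (gs : nat -> R).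
Variables (x : chi) (y : 'rV[R]_d).

Local Notation radius := (Defs.radius d c xi).
Local Notation nbhd := (nbhd c xi Y xs ys x y).
Local Notation activated := (activated c xi Y xs ys x y).
Local Notation activation_stage := (activation_stage c xi Y xs ys x y).
Local Notation psi := (largest_activated c xi Y xs ys x y).
Local Notation sample := (sample_set c xi Y xs ys x y).

(** A stage adds at most one run, so the size of a neighborhood skips no value. *)
Lemma nbhdS m t : nbhd m t.+1 = nbhd m t ++
  (if t \in nbhd m t.+1 then [:: t] else [::]).
Proof.
have E : iota 0 t.+1 = iota 0 t ++ [:: t] by rewrite -[t.+1]addn1 iotaD.
rewrite [LHS]/Defs.nbhd E filter_cat; congr cat.
by rewrite /= mem_filter mem_iota add0n ltnSn /= andbT.
Qed.

Lemma leq_size_nbhd m s t : (s <= t)%N -> (size (nbhd m s) <= size (nbhd m t))%N.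
Proof.
move=> /subnKC <-; elim: (t - s)%N => [|n IH]; first by rewrite addn0.
by rewrite (leq_trans IH)// addnS nbhdS size_cat leq_addr.
Qed.

Lemma size_nbhd_le m t : (size (nbhd m t) <= t)%N.
Proof. by rewrite size_filter (leq_trans (count_size _ _))// size_iota. Qed.

(** A discrete intermediate value argument: the size starts at 0, grows by at most one per stage,
    and reaches at least [m] by stage [t], hence equals [m] at some stage. *)
Lemma activation_stageP m t : activated m t ->
  exists2 s, activation_stage m t = Some s & size (nbhd m s) = m.
Proof.
move=> act; rewrite /Defs.activation_stage act.
pose p s := size (nbhd m s) == m; set s := find _ _; exists s => //.
have hasp : has p (iota 0 t.+1).
  move: act => /andP[_]; elim: t {s} => [|t IH] mt.
    apply/hasP; exists 0%N => //.
    by move: mt; rewrite /p [nbhd m 0]/= leqn0 => /eqP ->.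
  have [/IH /hasP[s sin ps]|ltm] := leqP m (size (nbhd m t)).
    apply/hasP; exists s => //; move: sin; rewrite !mem_iota !add0n /=.
    by move=> /leq_trans; apply.
  apply/hasP; exists t.+1; first by rewrite mem_iota add0n /= ltnSn.
  rewrite /p eqn_leq mt andbT nbhdS size_cat (leq_trans _ ltm)//.
  by rewrite -[X in (_ <= X)%N]addn1 leq_add2l; case: ifP.
have := nth_find 0%N hasp; rewrite -/s nth_iota ?add0n; first by move=> /eqP.
by move: hasp; rewrite has_find size_iota.
Qed.

Lemma sampleP t : (0 < psi t)%N ->
  exists2 s, sample t = nbhd (psi t) s & size (nbhd (psi t) s) = psi t.
Proof.
move=> psi0.
(* A maximum over an empty family is 0, so a positive maximum is attained. *)
have : activated (psi t) t.
  move: psi0; rewrite /largest_activated.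
  apply: (big_ind (fun m => (0 < m)%N -> activated m t)) => //.
  by move=> a b Ha Hb; rewrite /maxn; case: ifP.
by move=> /activation_stageP[s sE sz]; exists s => //; rewrite /sample_set sE.
Qed.

Lemma psi_ge m t : (0 < m)%N -> (m <= size (nbhd m t))%N -> (m <= psi t)%N.
Proof.
move=> m0 ms; have mt : (m < t.+1)%N by rewrite ltnS (leq_trans ms)// size_nbhd_le.
apply: (@leq_bigmax_cond _ _ (fun i : 'I_t.+1 => i : nat) (Ordinal mt)).
by rewrite /Defs.activated /= m0.
Qed.

Hypothesis filled : forall m, exists t, (m <= size (nbhd m t))%N.

(** Neighborhoods only grow, so an [m] once activated stays activated. *)
Lemma psi_cvg : psi @ \oo --> \oo.
Proof.
move=> A [N _ NA]; have [t0 Ht] := filled N.+1.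
exists t0 => // t /= t0t; apply: NA => /=; apply: ltnW.
by apply: psi_ge => //; exact: leq_trans Ht (leq_size_nbhd _ t0t).
Qed.

Lemma psi_near_ge N : \forall t \near \oo, (N <= psi t)%N.
Proof. by have := psi_cvg (nbhs_infty_ge N). Qed.

(** * Limits under bias and concentration bounds *)

Variables (fy sg K : R) (Z : nat -> R).
Hypothesis sg0 : 0 <= sg.
Hypothesis K0 : 0 <= K.
Hypothesis xi0 : 0 < xi.
Hypothesis d0 : (0 < d)%N.
Hypothesis c0 : 0 < c.
Hypothesis gsZ : forall m t i, i \in nbhd m t ->
  `|gs i - (fy + sg * Z i)| <= radius m * (K * (1 + `|Z i|)).
Hypothesis conc : forall k, exists N, forall m t, (N <= m)%N ->
  size (nbhd m t) = m ->
  `|\sum_(i <- nbhd m t) Z i| <= m%:R * k.+2%:R^-1 /\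
  `|\sum_(i <- nbhd m t) Z i ^+ 2 - m%:R| <= m%:R * k.+2%:R^-1.

Lemma radius_ge0 m : 0 <= radius m.
Proof. by rewrite /Defs.radius mulr_ge0 ?powR_ge0// ltW. Qed.

Lemma radius_cvg0 : radius @ \oo --> (0 : R).
Proof.
rewrite -[X in _ --> X](mulr0 c); apply: cvgMr.
have a0 : 0 < xi / d%:R by rewrite divr_gt0// ltr0n.
under eq_fun do rewrite powRN.
apply/cvgr0Pnorm_lt => e e0; near=> m.
have m0 : (0 < m)%N by near: m; exists 1%N.
have p0 : 0 < (m%:R : R) `^ (xi / d%:R) by rewrite powR_gt0// ltr0n.
rewrite gtr0_norm ?invr_gt0// invf_plt ?posrE//.
(* Writing [e^-1] as a power reduces the claim to [m] exceeding a fixed number. *)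
have -> : e^-1 = (e^-1 `^ (xi / d%:R)^-1) `^ (xi / d%:R).
  by rewrite -powRrM mulVf ?gt_eqF// powRr1// invr_ge0 ltW.
rewrite gt0_ltr_powR// ?nnegrE ?powR_ge0//.
by near: m; exact: nbhs_infty_gtr.
Unshelve. all: by end_near. Qed.

(** Since [psi] diverges, it eventually exceeds 1. Both estimators are then given by their formulas,
    and the sample is a neighborhood with exactly [psi t] runs. *)
Lemma average_near : \forall t \near \oo,
  [/\ (1 < psi t)%N, size (sample t) = psi t &
   forall i, i \in sample t ->
  `|gs i - (fy + sg * Z i)| <= radius (psi t) * (K * (1 + `|Z i|))].
Proof.
apply: filterS (psi_near_ge 2) => t t2.
have [s sE sz] := sampleP (ltnW t2); split => //; rewrite ?sE//.
by move=> i; exact: gsZ.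
Qed.

(** The sample has exactly [psi t] elements, so the concentration hypothesis applies with
    [m = psi t], whatever the stage of activation. *)
Lemma average_noise_near (e : R) : 0 < e -> \forall t \near \oo,
  `|average (sample t) Z| <= e /\
  `|average (sample t) (fun i => Z i ^+ 2) - 1| <= e.
Proof.
move=> e0; have /ltr_add_invr[k] := e0; rewrite add0r => ke.
have {}ke : k.+2%:R^-1 <= e.
  by rewrite (le_trans _ (ltW ke))// lef_pV2 ?posrE// ler_nat.
have [N HN] := conc k.
apply: filterS2 (psi_near_ge N) (psi_near_ge 1) => t Nt t1.
have [s sE sz] := sampleP t1; have [h1 h2] := HN _ s Nt sz.
have p0 : 0 < (psi t)%:R :> R by rewrite ltr0n.
rewrite /average sE sz; split.
  rewrite normrM gtr0_norm ?invr_gt0// ler_pdivrMl// (le_trans h1)//.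
  by rewrite ler_pM2l.
rewrite -[X in _ - X](mulVf (lt0r_neq0 p0)) -mulrBr.
rewrite normrM gtr0_norm ?invr_gt0// ler_pdivrMl// (le_trans h2)//.
by rewrite ler_pM2l.
Qed.

Lemma average_noise_cvg : (fun t => average (sample t) Z) @ \oo --> (0 : R).
Proof.
apply/cvgr0Pnorm_le => e e0.
by apply: filterS (average_noise_near e0) => t [].
Qed.

Lemma average_noise2_cvg :
  (fun t => average (sample t) (fun i => Z i ^+ 2)) @ \oo --> (1 : R).
Proof.
apply/cvgrPdist_le => e e0; apply: filterS (average_noise_near e0) => t [_].
by rewrite distrC.
Qed.

Let rad t := radius (psi t).

Lemma rad_cvg0 : rad @ \oo --> (0 : R).
Proof. exact: cvg_comp psi_cvg radius_cvg0. Qed.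

(** Since [1 + z ^+ 2] dominates [|z|], this majorizes the averaged noise factor of the bias; having
    a finite limit, it vanishes once multiplied by the radius. *)
Let A2 t := 1 + average (sample t) (fun i => Z i ^+ 2).

Let A2_cvg : A2 @ \oo --> (2 : R).
Proof. by apply: cvgD; [exact: cvg_cst|exact: average_noise2_cvg]. Qed.

Let A2E : \forall t \near \oo,
  A2 t = average (sample t) (fun i => 1 + Z i ^+ 2).
Proof.
apply: filterS average_near => t [t1 sz _].
by rewrite /A2 averageD average_cst// sz ltnW.
Qed.

Let norm_le_sqr (z : R) : `|z| <= 1 + z ^+ 2.
Proof. by rewrite -[z ^+ 2]real_normK ?num_real//; nra. Qed.

(** The centered output is [sg * Z i] plus a bias; the noise average tends to 0 by concentration,
    the bias average with the radius. *)
Lemma average_output_cvg :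
  (fun t => average (sample t) (fun i => gs i - fy)) @ \oo --> (0 : R).
Proof.
apply: (@cvg_dist_bound _ _ (fun t => sg * average (sample t) Z)
   (fun t => rad t * (2 * K) * A2 t)).
- apply: filterS2 average_near A2E => t [t1 sz near_y] ->.
  rewrite -!averageZ; apply: average_dist_le => i /near_y h.
  rewrite [X in `|X|](_ : _ = gs i - (fy + sg * Z i)); last by ring.
  apply: (le_trans h).
  (* It remains to see that [1 + |z| <= 2 * (1 + z ^+ 2)]. *)
  rewrite [leRHS](_ : _ = rad t * (K * (2 * (1 + Z i ^+ 2)))); last by ring.
  rewrite ler_wpM2l ?radius_ge0// ler_wpM2l//.
  move: (norm_le_sqr (Z i)) (sqr_ge0 (Z i)); lra.
- have H := cvgM (cvgM rad_cvg0 (cvg_cst (2 * K))) A2_cvg.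
  by rewrite !mul0r in H; exact: H.
- have H := cvgM (cvg_cst sg) average_noise_cvg.
  by rewrite mulr0 in H; exact: H.
Qed.

Lemma average_output2_cvg :
  (fun t => average (sample t) (fun i => (gs i - fy) ^+ 2)) @ \oo --> sg ^+ 2.
Proof.
apply: (@cvg_dist_bound _ _
   (fun t => sg ^+ 2 * average (sample t) (fun i => Z i ^+ 2))
   (fun t => (rad t * (4 * sg * K) + rad t * rad t * (2 * K ^+ 2)) * A2 t)).
- apply: filterS2 average_near A2E => t [t1 sz near_y] ->.
  rewrite -!averageZ; apply: average_dist_le => i /near_y h.
  set z := Z i; set r := rad t; set e := gs i - (fy + sg * z).
  have r0 : 0 <= r by exact: radius_ge0.
  have he : `|e| <= r * K * (1 + `|z|) by rewrite -mulrA.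
  (* A difference of two squares, factored so that the bias [e] comes out. *)
  rewrite [X in `|X|](_ : _ = e * (2 * sg * z + e)); last by rewrite /e; ring.
  have rK0 : 0 <= r * K by rewrite mulr_ge0.
  have b0 := normr_ge0 z; have e0 := normr_ge0 e.
  rewrite normrM -[z ^+ 2]real_normK ?num_real//.
  have : `|2 * sg * z + e| <= 2 * sg * `|z| + r * K * (1 + `|z|).
    by rewrite (le_trans (ler_normD _ _))// lerD// normrM ger0_norm// mulr_ge0.
  move=> /(ler_pM e0 (normr_ge0 _) he) /le_trans; apply.
  have -> : r * (4 * sg * K) + r * r * (2 * K ^+ 2) =
    (r * K) * (4 * sg) + (r * K) ^+ 2 * 2 by ring.
  move: (r * K) rK0 (`|z|) b0 => a a0 b b0.
  (* The cross term needs [2 * (b + b ^+ 2) <= 4 * (1 + b ^+ 2)], the quadratic one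
     [(1 + b) ^+ 2 <= 2 * (1 + b ^+ 2)]. *)
  have b2 : 0 <= 4 + 2 * b ^+ 2 - 2 * b by have := sqr_ge0 (b - 1); lra.
  have := mulr_ge0 (mulr_ge0 a0 sg0) b2; have := sqr_ge0 (a * (1 - b)); lra.
- have H := cvgM (cvgD (cvgM rad_cvg0 (cvg_cst (4 * sg * K)))
    (cvgM (cvgM rad_cvg0 rad_cvg0) (cvg_cst (2 * K ^+ 2)))) A2_cvg.
  by rewrite !mul0r addr0 mul0r in H; exact: H.
- have H := cvgM (cvg_cst (sg ^+ 2)) average_noise2_cvg.
  by rewrite mulr1 in H; exact: H.
Qed.

Local Notation mean_est := (mean_estimator c xi Y xs ys gs x y).

Lemma mean_estimator_near (dflt : nat -> R) : \forall t \near \oo,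
  mean_est (dflt t) t = average (sample t) (fun i => gs i - fy) + fy.
Proof.
apply: filterS average_near => t [t1 sz _].
rewrite /mean_estimator (ltnW t1) -sz -/(average _ _) averageD average_cst ?subrK//.
by rewrite sz ltnW.
Qed.

Lemma mean_estimator_cvg (dflt : nat -> R) :
  (fun t => mean_est (dflt t) t) @ \oo --> fy.
Proof.
have H := cvgD average_output_cvg (cvg_cst fy); rewrite add0r in H.
apply: (cvg_near_eq (mean_estimator_near dflt)).
exact: H.
Qed.

Lemma sd_estimator_cvg (dflt : nat -> R) :
  (fun t => sd_estimator c xi Y xs ys gs x y (dflt t) t) @ \oo --> sg.
Proof.
rewrite -[sg]ger0_norm// -sqrtr_sqr.
(* The sample variance with outputs centered at [fy]: mean of squares minus square of the mean,
   where [1 + 1 / (psi - 1)] is the correction [psi / (psi - 1)]. *)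
pose V t := (1 + ((psi t).-1%:R)^-1) *
  (average (sample t) (fun i => (gs i - fy) ^+ 2) -
   average (sample t) (fun i => gs i - fy) * average (sample t) (fun i => gs i - fy)).
have Vcvg : V @ \oo --> sg ^+ 2.
  have u0 : (fun n => n.-1%:R^-1 : R) @ \oo --> (0 : R).
    (* Shifting by 2 turns [n.-1] into [n.+1], the harmonic sequence. *)
    rewrite -(cvg_shiftn 2).
    suff -> : [sequence (n + 2).-1%:R^-1 : R]_n = harmonic by exact: cvg_harmonic.
    by apply/funext => n; rewrite /= addn2.
  have up0 : (fun t => (psi t).-1%:R^-1 : R) @ \oo --> (0 : R).
    exact: cvg_comp psi_cvg u0.
  have H := cvgM (cvgD (cvg_cst (1 : R)) up0)
    (cvgB average_output2_cvg (cvgM average_output_cvg average_output_cvg)).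
  by rewrite addr0 mul0r subr0 mul1r in H; exact: H.
have H := continuous_cvg _ (@sqrt_continuous R (sg ^+ 2)) Vcvg.
apply: (@cvg_near_eq _ _ (fun t => Num.sqrt (V t))); last exact: H.
apply: filterS2 average_near (mean_estimator_near dflt) => t [t1 sz _] mE.
rewrite /sd_estimator t1 mE /V; congr Num.sqrt.
set a := average _ _.
have p0 : (psi t)%:R != 0 :> R by rewrite pnatr_eq0 -lt0n ltnW.
have p1 : (psi t).-1%:R != 0 :> R by rewrite pnatr_eq0 -lt0n -ltnS prednK// ltnW.
have pE : (psi t)%:R = (psi t).-1%:R + 1 :> R by rewrite natr1 prednK// ltnW.
have -> : \sum_(i <- sample t) (gs i - (a + fy)) ^+ 2 =
   (psi t)%:R * (average (sample t) (fun i => (gs i - fy) ^+ 2) - a * a).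
  have aE : \sum_(i <- sample t) (gs i - fy) = (psi t)%:R * a.
    by rewrite /a /average sz mulVKf.
  rewrite mulrBr /average sz mulVKf//.
  rewrite (eq_bigr (fun i => (gs i - fy) ^+ 2 + ((- (2 * a)) * (gs i - fy) + a * a))).
    rewrite !big_split/= -mulr_sumr aE big_const_seq count_predT iter_addr_0 sz.
    by rewrite -[_ *+ psi t]mulr_natl; ring.
  by move=> i _; ring.
rewrite mulrA; congr (_ * _); rewrite pE addrK; field.
exact: p1.
Qed.

End path.

(** * The sampling model *)

Lemma measurable_preimageType d d' (T : measurableType d)
    (T' : measurableType d') (X : T -> T') :
  measurable_fun (setT : set (g_sigma_algebra_preimageType X)) X.
Proof. by move=> _ B mB; exists B. Qed.

(** The preimage splits over the finitely many values of [U]; as [V] stays in [A], measurability of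
    each [g x] on [A] suffices. *)
Lemma measurable_fun_discrete_param d d1 (T0 : measurableType d)
    (S : measurableType d1) (R : realType)
    (chi : finType) (x0 : chi) (A : set S) (g : chi -> S -> R)
    (U : T0 -> discrete x0) (V : T0 -> S) :
  measurable A -> (forall x, measurable_fun A (g x)) ->
  measurable_fun setT U -> measurable_fun setT V -> (forall w, A (V w)) ->
  measurable_fun setT (fun w => g (U w) (V w)).
Proof.
move=> mA mg mU mV AV _ B mB; rewrite setTI.
rewrite (_ : _ @^-1` _ =
    \big[setU/set0]_(x : chi) (U @^-1` [set x] `&` V @^-1` (A `&` g x @^-1` B))).
  apply: bigsetU_measurable => x _; apply: measurableI.
    by rewrite -[X in measurable X]setTI; exact: mU.
  by rewrite -[X in measurable X]setTI; apply: mV => //; exact: mg.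
rewrite -bigcup_seq; apply/seteqP; split => [w Bw|w [x _ [/= -> [_ //]]]].
by exists (U w); [rewrite /= mem_index_enum|split => //; split].
Qed.

Section sampled_path.
Context (R : realType) (d : nat) (chi : finType) (x0 : chi).
Context dO (Omega : measurableType dO) (P : probability Omega R).
Variables (Y : set 'rV[R]_d) (f sigma : chi -> 'rV[R]_d -> R).
Variables (dec : nat -> {RV P >-> discrete x0})
  (ctx : nat -> {RV P >-> 'rV[R]_d}) (err : nat -> {RV P >-> R}).
Variables (L1 L2 : R).
Hypothesis L1_gt0 : 0 < L1.
Hypothesis L2_gt0 : 0 < L2.
Hypothesis f_lipschitz : forall x, elipschitz_on L1 Y (f x).
Hypothesis sigma_gt0 : forall x y, Y y -> 0 < sigma x y.
Hypothesis sigma_lipschitz : forall x, elipschitz_on L2 Y (sigma x).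
Hypothesis ctx_int : forall t w, Y° (ctx t w).

Local Notation output := (output f dec ctx err).
Local Notation history := (history f dec ctx err).
Local Notation point := (Defs.point dec ctx).
Local Notation Z := (standardized_error sigma dec ctx err).

Let mY : measurable Y°.
Proof. by apply: open_measurable_rV; exact: open_interior. Qed.

Lemma measurable_noise_mean d0 (T0 : measurableType d0) (U : T0 -> discrete x0)
    (V : T0 -> 'rV[R]_d) : measurable_fun setT U -> measurable_fun setT V ->
  (forall w, Y° (V w)) -> measurable_fun setT (fun w => f (U w) (V w)).
Proof.
move=> mU mV YV; apply: (measurable_fun_discrete_param (A := Y°) (U := U)) => // x.
exact: (elipschitz_measurable L1_gt0 (@f_lipschitz x)).
Qed.

Lemma measurable_noise_sd d0 (T0 : measurableType d0) (U : T0 -> discrete x0)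
    (V : T0 -> 'rV[R]_d) : measurable_fun setT U -> measurable_fun setT V ->
  (forall w, Y° (V w)) -> measurable_fun setT (fun w => (sigma (U w) (V w))^-1).
Proof.
move=> mU mV YV; apply: measurable_fun_invr.
  by move=> w; rewrite ltW// sigma_gt0//; exact: interior_subset (YV w).
apply: (measurable_fun_discrete_param (A := Y°) (U := U)) => // x.
exact: (elipschitz_measurable L2_gt0 (@sigma_lipschitz x)).
Qed.

Lemma measurable_output i : measurable_fun setT (output i).
Proof. by apply: measurable_funD => //; exact: measurable_noise_mean. Qed.

Lemma measurable_standardized_error i : measurable_fun setT (Z i).
Proof. by apply: measurable_funM => //; exact: measurable_noise_sd. Qed.

Lemma measurable_history t : measurable_fun setT (history t).
Proof.
apply/measurable_fun_tnthP => i.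
rewrite (_ : _ \o _ = fun w => (point i w, output i w)); last first.
  by apply/funext => w; rewrite /= tnth_mktuple.
by apply: measurable_fun_pair; [exact: measurable_fun_pair|exact: measurable_output].
Qed.

(** * Measurability with respect to the past *)

Section past.
Context d0 (T0 : measurableType d0) (rho : T0 -> Omega) (t : nat).
Hypothesis mhist : measurable_fun setT (history t \o rho).

(** In its uses [rho] is the identity into [Omega] from a copy with a coarser sigma-algebra, so
    these facts say what the history determines. *)
Let mentry i : (i < t)%N ->
  measurable_fun setT (fun w => (point i (rho w), output i (rho w))).
Proof.
move=> it; have /measurable_fun_tnthP/(_ (Ordinal it)) := mhist.
by congr measurable_fun; apply/funext => w; rewrite /= tnth_mktuple.
Qed.

Lemma measurable_past_dec i : (i < t)%N -> measurable_fun setT (dec i \o rho).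
Proof.
move=> it; exact: measurableT_comp measurable_fst (measurableT_comp measurable_fst (mentry it)).
Qed.

Lemma measurable_past_ctx i : (i < t)%N -> measurable_fun setT (ctx i \o rho).
Proof.
move=> it; exact: measurableT_comp measurable_snd (measurableT_comp measurable_fst (mentry it)).
Qed.

(** The standardized error can be recovered from the data: subtract [f] from the output and divide
    by [sigma], both taken at the sampled point. *)
Lemma measurable_past_error i : (i < t)%N -> measurable_fun setT (Z i \o rho).
Proof.
move=> it.
have mout : measurable_fun setT (output i \o rho).
  exact: measurableT_comp measurable_snd (mentry it).
rewrite (_ : _ \o _ = fun w =>
    (output i (rho w) - f (dec i (rho w)) (ctx i (rho w))) *
    (sigma (dec i (rho w)) (ctx i (rho w)))^-1); last first.
  by apply/funext => w; rewrite /= /output addrAC subrr add0r.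
have mdec := measurable_past_dec it; have mctx := measurable_past_ctx it.
apply: measurable_funM.
  apply: measurable_funB => //.
  exact: (measurable_noise_mean mdec mctx (fun w => @ctx_int i (rho w))).
exact: (measurable_noise_sd mdec mctx (fun w => @ctx_int i (rho w))).
Qed.

End past.

Variables (c xi : R) (x : chi) (y : 'rV[R]_d).

Definition in_nbhd (m i : nat) (w : Omega) : bool :=
  [&& dec i w == x, enorm (ctx i w - y) < Defs.radius d c xi m & `[< Y° (ctx i w) >]].

Lemma measurable_in_nbhd d0 (T0 : measurableType d0) (rho : T0 -> Omega) m i :
  measurable_fun setT (dec i \o rho) -> measurable_fun setT (ctx i \o rho) ->
  measurable_fun setT (in_nbhd m i \o rho).
Proof.
move=> mdec mctx.
rewrite (_ : _ \o _ = fun w => (dec i (rho w) == x) &&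
    (enorm (ctx i (rho w) - y) < Defs.radius d c xi m)); last first.
  apply/funext => w; rewrite /= /in_nbhd; case: asboolP; first by rewrite andbT.
  by have := ctx_int i (rho w).
apply: measurable_and.
  apply: (measurableT_comp (f := fun u : discrete x0 => u == x)) mdec.
  by [].
apply: measurable_fun_ltr => //.
exact: measurableT_comp (measurable_enorm_sub y) mctx.
Qed.

Lemma size_nbhd_hits m t w :
  size (nbhd c xi Y (fun i => dec i w) (fun i => ctx i w) x y m t) =
  hits in_nbhd m t w.
Proof.
rewrite /nbhd size_filter -sum1_count /hits
  -(big_mkord predT (fun i => in_nbhd m i w : nat)) big_mkcond /index_iota subn0.
by apply: eq_bigr => i _; rewrite -/(in_nbhd m i w); case: in_nbhd.
Qed.

Lemma sum_nbhd m t w (F : nat -> R) :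
  \sum_(i <- nbhd c xi Y (fun i => dec i w) (fun i => ctx i w) x y m t) F i =
  \sum_(i < t | in_nbhd m i w) F i.
Proof. by rewrite /nbhd big_filter -(big_mkord (in_nbhd m ^~ w)) /index_iota subn0. Qed.

(** Replacing [f] at the sampled context by its value at [y] costs at most [L1 * r], and replacing
    [sigma] at most [L2 * r * |Z|], with [r] the radius. *)
Lemma output_approx m t w i : Y° y ->
  i \in nbhd c xi Y (fun i => dec i w) (fun i => ctx i w) x y m t ->
  `|output i w - (f x y + sigma x y * Z i w)| <=
    Defs.radius d c xi m * ((L1 + L2) * (1 + `|Z i w|)).
Proof.
move=> Yy; rewrite mem_filter => /andP[/and3P[/eqP dx /ltW near_y _] _].
have Yi : Y (ctx i w) by exact: interior_subset (@ctx_int i w).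
have {}Yy : Y y := interior_subset Yy.
have errE : err i w = sigma x (ctx i w) * Z i w.
  by rewrite /standardized_error dx mulrCA divff ?mulr1// gt_eqF// sigma_gt0.
rewrite /output dx errE.
rewrite [X in `|X|](_ : _ = (f x (ctx i w) - f x y) +
   (sigma x (ctx i w) - sigma x y) * Z i w); last by ring.
have hf := f_lipschitz x Yi Yy; have hs := sigma_lipschitz x Yi Yy.
set r := Defs.radius _ _ _ _ in near_y *.
have z0 := normr_ge0 (Z i w).
have r0 : 0 <= r by rewrite (le_trans _ near_y)// enorm_ge0.
rewrite (le_trans (ler_normD _ _))// normrM.
apply: (@le_trans _ _ (L1 * r + L2 * r * `|Z i w|)).
  apply: lerD; first by rewrite (le_trans hf)// ler_pM2l.
  by rewrite ler_wpM2r// (le_trans hs)// ler_pM2l.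
have := mulr_ge0 r0 (ltW L2_gt0); have := mulr_ge0 (mulr_ge0 r0 (ltW L1_gt0)) z0; lra.
Qed.

Hypothesis err_indep : errors_independent f sigma dec ctx err.

(** [X t] is taken to be the history with the current point: it decides whether run [t] hits and is
    independent of its standardized error. *)
Lemma errors_concentrate (e : R) : 0 < e < 1 ->
  {ae P, forall w, exists N, forall m t, (N <= m)%N ->
    hits in_nbhd m t w = m ->
    `|\sum_(i < t | in_nbhd m i w) Z i w| <= m%:R * e /\
    `|\sum_(i < t | in_nbhd m i w) Z i w ^+ 2 - m%:R| <= m%:R * e}.
Proof.
case: err_indep => lawZ _ indep.
have mX t : measurable_fun setT (fun w => (history t w, point t w)).
  apply: measurable_fun_pair; first exact: measurable_history.
  exact: measurable_fun_pair.
apply: (sums_concentrate (X := fun t w => (history t w, point t w))) => //.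
- exact: measurable_standardized_error.
- move=> i t it.
  set T0 := g_sigma_algebra_preimageType _.
  have mXt : @measurable_fun _ _ T0 _ setT (fun w => (history t w, point t w)).
    exact: measurable_preimageType.
  apply: (@measurable_past_error _ T0 id t) it.
  exact: measurableT_comp measurable_fst mXt.
- move=> m i t it.
  set T0 := g_sigma_algebra_preimageType _.
  have mXt : @measurable_fun _ _ T0 _ setT (fun w => (history t w, point t w)).
    exact: measurable_preimageType.
  have mh : measurable_fun setT (history t \o (id : T0 -> Omega)).
    exact: measurableT_comp measurable_fst mXt.
  have mp : measurable_fun setT (point t \o (id : T0 -> Omega)).
    exact: measurableT_comp measurable_snd mXt.
  apply: (@measurable_in_nbhd _ T0 id).
    (* The run [t] itself is read off the current point, earlier runs off the history. *)
    move: it; rewrite leq_eqVlt => /orP[/eqP->|it].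
      exact: measurableT_comp measurable_fst mp.
    exact: (measurable_past_dec mh it).
  move: it; rewrite leq_eqVlt => /orP[/eqP->|it].
    exact: measurableT_comp measurable_snd mp.
  exact: (measurable_past_ctx mh it).
Qed.

End sampled_path.

(** * Filling of the neighborhoods *)

Lemma count_infinitely_often (b : pred nat) :
  (forall k, exists2 i, (k <= i)%N & b i) ->
  forall m, exists t, (m <= count b (iota 0 t))%N.
Proof.
move=> io; elim=> [|m [t mt]]; first by exists 0%N.
have [i ti bi] := io t; exists i.+1.
rewrite -[i.+1]addn1 iotaD count_cat /= add0n bi addn0 addn1 ltnS.
by rewrite (leq_trans mt)// -(subnKC ti) iotaD count_cat leq_addr.
Qed.

(** A box around [y] inside the neighborhood has positive volume, so by the density bound every run
    falls into it with conditional probability bounded below, and infinitely many do. *)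
Lemma nbhd_filled (R : realType) (d : nat) (chi : finType) (x0 : chi)
    (dO : measure_display) (Omega : measurableType dO) (P : probability Omega R)
    (Y : set 'rV[R]_d) (f : chi -> 'rV[R]_d -> R)
    (dec : nat -> {RV P >-> discrete x0}) (ctx : nat -> {RV P >-> 'rV[R]_d})
    (err : nat -> {RV P >-> R})
    (p : forall t : nat, t.-tuple (discrete x0 * 'rV[R]_d * R) -> chi -> R)
    (fY : forall t : nat,
       t.-tuple (discrete x0 * 'rV[R]_d * R) -> chi -> 'rV[R]_d -> R)
    (lambdaL c xi : R) (x : chi) (y : 'rV[R]_d) :
  (forall t, measurable_fun setT (history f dec ctx err t)) ->
  sequential_sampling Y f dec ctx err p fY ->
  0 < lambdaL ->
  (forall t w x y, Y° y -> lambdaL < sampling_density f dec ctx err p fY t w x y) ->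
  0 < c -> Y° y ->
  {ae P, forall w, forall m, exists t,
    (m <= size (nbhd c xi Y (fun i => dec i w) (fun i => ctx i w) x y m t))%N}.
Proof.
move=> mhist sampling l0 density_gt c0 Yy.
suff H : {ae P, forall w, forall m, exists t, (m.+1 <=
    size (nbhd c xi Y (fun i => dec i w) (fun i => ctx i w) x y m.+1 t))%N}.
  by apply: filterS H => w H [|m]; [exists 0%N|exact: H].
apply: ae_foralln => m.
have r0 : 0 < Defs.radius d c xi m.+1 by rewrite mulr_gt0// powR_gt0// ltr0n.
have [Q mQ [QY Qr [l lgt0 lQ]]] := box_in_ball Yy r0.
pose E i := dec i @^-1` [set x] `&` ctx i @^-1` Q.
have mE i : measurable (E i).
  have mdec : measurable_fun setT (dec i) by [].
  have mctx : measurable_fun setT (ctx i) by [].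
  apply: measurableI; rewrite -[X in measurable X]setTI; first exact: mdec.
  exact: mctx.
have ll0 : 0 < lambdaL * l by rewrite mulr_gt0.
have ioE : {ae P, forall w, forall k, exists2 i, (k <= i)%N & E i w}.
  apply: (infinitely_often mE ll0) => k n.
  set M := \bigcap_(_ in _) _.
  (* Missing the box in earlier runs is an event of the history, as the conditional density identity
     requires. *)
  have [H mH HM] : exists2 H, measurable H & history f dec ctx err (k + n) @^-1` H = M.
    pose T0 : measurableType _ :=
      g_sigma_algebra_preimageType (history f dec ctx err (k + n)).
    have mh : measurable_fun setT (history f dec ctx err (k + n) \o (id : T0 -> Omega)).
      exact: measurable_preimageType.
    have : @measurable _ T0 M.
      apply: bigcap_measurableType => j /= /andP[_ jkn].
      have mdec := measurable_past_dec mh jkn.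
      have mctx := measurable_past_ctx mh jkn.
      apply: measurableC; rewrite -[X in measurable X]setTI setIIr.
      by apply: measurableI; [exact: mdec|exact: mctx].
    by move=> [H mH HE]; exists H; rewrite // -HE setTI.
  rewrite -HM /E (conditional_density sampling)// setIidl//.
  have mMP : measurable (history f dec ctx err (k + n) @^-1` H).
    by rewrite -[X in measurable X]setTI; exact: mhist.
  (* The density exceeds [lambdaL] on the box, so the inner integral is at least [lambdaL * l] for
     every history. *)
  rewrite -integral_cst//; apply: ge0_le_integral_nonmeasurable => w _.
    by rewrite lee_fin ltW.
  rewrite EFinM -lQ -integral_cst//.
  apply: ge0_le_integral_nonmeasurable => v Qv; first by rewrite lee_fin ltW.
  by rewrite lee_fin ltW// density_gt//; exact: QY.
apply: filterS ioE => w io.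
have hit_io k : exists2 i, (k <= i)%N & in_nbhd Y dec ctx c xi x y m.+1 i w.
  have [i ki [/= di Qi]] := io k; exists i => //.
  by rewrite /in_nbhd di eqxx Qr//=; apply/asboolP; exact: QY.
have [t mt] := count_infinitely_often hit_io m.+1.
by exists t; rewrite /nbhd size_filter.
Qed.

Theorem theorem1
  (R : realType) (d : nat) (d_gt0 : (0 < d)%N)
  (chi : finType) (x0 : chi)
  (Y : set 'rV[R]_d) (Y_bounded : bounded_set Y)
  (f sigma : chi -> 'rV[R]_d -> R)
  (noise : chi -> 'rV[R]_d -> probability (measurableTypeR R) R)
  (L1 L2 : R) (L1_gt0 : 0 < L1) (L2_gt0 : 0 < L2)
  (f_bounded : forall x : chi, [bounded f x y | y in Y])
  (f_lipschitz : forall x : chi, elipschitz_on L1 Y (f x))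
  (sigma_gt0 : forall (x : chi) (y : 'rV[R]_d), Y y -> 0 < sigma x y)
  (noise_normal : forall (x : chi) (y : 'rV[R]_d), Y y ->
     forall E : set R, measurable E ->
       noise x y E = normal_prob 0 (sigma x y) E)
  (sigma_lipschitz : forall x : chi, elipschitz_on L2 Y (sigma x))
  (dO : measure_display) (Omega : measurableType dO) (P : probability Omega R)
  (dec : nat -> {RV P >-> discrete x0})
  (ctx : nat -> {RV P >-> 'rV[R]_d})
  (err : nat -> {RV P >-> R})
  (err_law : errors_follow_noise noise dec ctx err)
  (err_indep : errors_independent f sigma dec ctx err)
  (p : forall t : nat, t.-tuple (discrete x0 * 'rV[R]_d * R) -> chi -> R)
  (fY : forall t : nat,
     t.-tuple (discrete x0 * 'rV[R]_d * R) -> chi -> 'rV[R]_d -> R)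
  (sampling : sequential_sampling Y f dec ctx err p fY)
  (lambdaL : R) (lambdaL_gt0 : 0 < lambdaL)
  (density_gt : forall (t : nat) (w : Omega) (x : chi) (y : 'rV[R]_d),
     Y° y -> lambdaL < sampling_density f dec ctx err p fY t w x y)
  (xi c : R) (xi_gt0 : 0 < xi) (c_gt0 : 0 < c)
  (mean_dflt sd_dflt : chi -> 'rV[R]_d -> nat -> Omega -> R) :
  forall (x : chi) (y : 'rV[R]_d), Y° y ->
    {ae P, forall w,
       (fun t => mean_estimator c xi Y (fun i => dec i w) (fun i => ctx i w)
          (fun i => output f dec ctx err i w) x y (mean_dflt x y t w) t)
         @ \oo --> f x y} /\
    {ae P, forall w,
       (fun t => sd_estimator c xi Y (fun i => dec i w) (fun i => ctx i w)
          (fun i => output f dec ctx err i w) x y (sd_dflt x y t w) t)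
         @ \oo --> sigma x y}.
Proof.
move=> x y Yy.
have ctx_int := ctx_interior sampling.
have mhist t : measurable_fun setT (history f dec ctx err t).
  by apply: measurable_history; [exact: L1_gt0|exact: f_lipschitz|exact: ctx_int].
have filled := nbhd_filled xi x mhist sampling lambdaL_gt0 density_gt c_gt0 Yy.
have conc : {ae P, forall w, forall k, exists N, forall m t, (N <= m)%N ->
    size (nbhd c xi Y (fun i => dec i w) (fun i => ctx i w) x y m t) = m ->
    `|\sum_(i <- nbhd c xi Y (fun i => dec i w) (fun i => ctx i w) x y m t)
        standardized_error sigma dec ctx err i w| <= m%:R * k.+2%:R^-1 /\
    `|\sum_(i <- nbhd c xi Y (fun i => dec i w) (fun i => ctx i w) x y m t)
        standardized_error sigma dec ctx err i w ^+ 2 - m%:R| <= m%:R * k.+2%:R^-1}.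
  (* Countably many tolerances allow one null set for all; [k.+2] keeps each of them below 1. *)
  apply: ae_foralln => k.
  have k1 : 0 < (k.+2%:R^-1 : R) < 1 by rewrite invr_gt0 invf_lt1 ?ltr0n ?ltr1n.
  have H := errors_concentrate L1_gt0 L2_gt0 f_lipschitz sigma_gt0
    sigma_lipschitz ctx_int c xi x y err_indep k1.
  apply: filterS H => w [N HN]; exists N => m t Nm.
  by rewrite size_nbhd_hits !sum_nbhd; exact: HN.
have sg0 : 0 <= sigma x y by rewrite ltW// sigma_gt0//; exact: interior_subset Yy.
have K0 : 0 <= L1 + L2 by rewrite ltW// addr_gt0.
have approx w m t i := @output_approx _ _ _ x0 _ _ P _ _ _ dec ctx err _ _
  L1_gt0 L2_gt0 f_lipschitz sigma_gt0 sigma_lipschitz ctx_int c xi x _ m t w i Yy.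
(* On the almost sure event where all neighborhoods fill and the sums concentrate, both limits are
   deterministic facts about the path. *)
split; apply: filterS2 filled conc => w fw cw.
- exact: (mean_estimator_cvg fw K0 xi_gt0 d_gt0 c_gt0 (approx w) cw
    (fun t => mean_dflt x y t w)).
- exact: (sd_estimator_cvg fw sg0 K0 xi_gt0 d_gt0 c_gt0 (approx w) cw
    (fun t => sd_dflt x y t w)).
Qed.
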